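(* Let $r\ge2$ and let $\mathcal{P}=\{P,Q\}$ be a set of two distinct $r$-patterns. (i) If $P$ and $Q$ are harmonious, then there are constants $0<c<C$ such that a.a.s. $c\,n^{1/(r-1)}\le z_{\mathcal P}(\mathbb{RM}^{(r)}_{n})\le C\,n^{1/(r-1)}$. (ii) If $P$ and $Q$ form a mismatch, then there are constants $0<c<C$ such that a.a.s. $c\,n^{1/r}\le z_{\mathcal P}(\mathbb{RM}^{(r)}_{n})\le C\,n^{1/r}$. (iii) If neither $P$ nor $Q$ is collectable, then a.a.s. $z_{\mathcal P}(\mathbb{RM}^{(r)}_{n})=z_{\mathcal P}$, where $z_{\mathcal P}$ is the largest size of any $\mathcal P$-clique whatsoever; this is an integer with $2\le z_{\mathcal P}\le 5$.
   Context: An ordered $r$-matching of size $n$ is a set of $n$ pairwise disjoint $r$-element subsets (edges) of a linearly ordered vertex set of size $rn$; $\mathbb{RM}^{(r)}_n$ is a uniformly random ordered $r$-matching on $[rn]$. Matchings are written as words (each edge gets a letter; each vertex is replaced by its edge's letter). An $r$-pattern is an ordered $r$-matching of size 2, written as a word over $\{A,B\}$ with each letter appearing $r$ times and beginning with $A$. Two edges form pattern $P$ if they induce a matching order-isomorphic to $P$. For a set $\mathcal P$ of $r$-patterns, a $\mathcal P$-clique is an ordered matching all of whose pairs of edges form patterns in $\mathcal P$, and $z_{\mathcal P}(M)$ is the largest size of a $\mathcal P$-clique contained in $M$. An $r$-pattern $P$ is collectable if it can be split into consecutive blocks $P=S_1\cdots S_s$ each of the form $A^tB^t$ or $B^tA^t$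 ($t\ge1$; $W^t$ denotes $t$ repetitions); this splitting is unique, and the composition of $P$ is $\lambda_P=(|S_1|/2,\dots,|S_s|/2)$. Two distinct collectable $r$-patterns $P,Q$ are harmonious if $\lambda_P=\lambda_Q$. A pair $\{P,Q\}$ is a mismatch if exactly one of $P,Q$ is collectable, or both are collectable but $\lambda_P\ne\lambda_Q$. ''A.a.s.'' means with probability tending to 1 as $n\to\infty$. *)

(* Defs.v *)
From HB Require Import structures.
From mathcomp Require Import all_boot all_order all_algebra.
From mathcomp Require Import reals exp.
Set Implicit Arguments. Unset Strict Implicit. Unset Printing Implicit Defensive.
Import Order.TTheory GRing.Theory Num.Theory.

(* A labelled ordered r-matching of size n: vertex set 'I_(r*n) (= [rn]),
   each vertex mapped to the label (in 'I_n) of its edge; valid iff every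
   label is used exactly r times.  This is the "word" representation. *)
Definition lmatching (r n : nat) := {ffun 'I_(r * n) -> 'I_n}.

Definition valid_matching r n (M : lmatching r n) : bool :=
  [forall e : 'I_n, #|[set i | M i == e]| == r].

(* r-patterns: words over {A,B} encoded as seq bool (false = A, true = B),
   of length 2r, each letter r times, starting with A. *)
Definition is_pattern (r : nat) (P : seq bool) : bool :=
  [&& size P == 2 * r, count id P == r & head true P == false].

(* The word induced by the two edges e, f of M (in vertex order), with the
   letter of the first vertex renamed A and the other B. *)
Definition pair_word r n (M : lmatching r n) (e f : 'I_n) : seq bool :=
  let s := [seq M i | i <- enum 'I_(r * n) & (M i == e) || (M i == f)] in
  [seq x != head e s | x <- s].

Definition forms_PQ r n (P Q : seq bool) (M : lmatching r n) (e f : 'I_n) : bool :=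
  (pair_word M e f == P) || (pair_word M e f == Q).

Definition is_clique r n (P Q : seq bool) (M : lmatching r n) (S : {set 'I_n}) : bool :=
  [forall e in S, forall f in S, (e != f) ==> forms_PQ P Q M e f].

Definition zPQ r n (P Q : seq bool) (M : lmatching r n) : nat :=
  \max_(S : {set 'I_n} | is_clique P Q M S) #|S|.

(* Probability for the uniformly random ordered r-matching on [rn].  Every
   matching corresponds to exactly n! labellings, so uniform labellings
   induce the uniform distribution on matchings (all events considered are
   label-invariant). *)
Definition prob (R : realType) r n (E : lmatching r n -> bool) : R :=
  (#|[set M : lmatching r n | valid_matching M && E M]|%:R /
   #|[set M : lmatching r n | valid_matching M]|%:R)%R.

Definition aas (R : realType) r (E : forall n, lmatching r n -> bool) : Prop :=
  forall eps : R, (0 < eps)%R ->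
    exists N : nat, forall n : nat, (N <= n)%N -> (1 - eps <= prob R (E n))%R.

(* Collectable patterns: decomposition into consecutive blocks A^tB^t (b=false)
   or B^tA^t (b=true), t >= 1.  bs lists the blocks (b, t). *)
Definition block_decomp (P : seq bool) (bs : seq (bool * nat)) : Prop :=
  all (fun bt => 0 < bt.2)%N bs /\
  P = flatten [seq nseq bt.2 bt.1 ++ nseq bt.2 (~~ bt.1) | bt <- bs].

Definition collectable (P : seq bool) : Prop := exists bs, block_decomp P bs.

(* composition lambda_P = (t_1, ..., t_s) = map snd bs (decomposition is unique) *)
Definition harmonious (P Q : seq bool) : Prop :=
  P <> Q /\ exists bsP bsQ, block_decomp P bsP /\ block_decomp Q bsQ /\
                         map snd bsP = map snd bsQ.

Definition mismatch (P Q : seq bool) : Prop :=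
  (collectable P /\ ~ collectable Q) \/ (~ collectable P /\ collectable Q) \/
  (collectable P /\ collectable Q /\
   forall bsP bsQ, block_decomp P bsP -> block_decomp Q bsQ ->
     map snd bsP <> map snd bsQ).

(* Main.v *)
(* A uniformly random ordered matching is obtained by giving every vertex (e, a)
   of every edge e an independent uniform value in a large range [L] and reading
   the edge labels in increasing order of the values; conditioning on the absence
   of ties costs a factor at most 2.

   Upper bounds are first-moment bounds: up to a factor C^k, the expected number
   of cliques of size k is n^k |W_k| / (k! (rk)!), where W_k is the set of labelled
   {P, Q}-cliques of size k.  Write P = X b ..., Q = X b' ... with b <> b'.  If P
   and Q are harmonious, X is balanced, and a clique is determined by the orders of
   its first and of its (|X|/2 + 1)-st vertices, so |W_k| <= k^(2k).  If they form a
   mismatch, then after removing a balanced prefix from each and normalising the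
   first letter, the remainders first differ after an unbalanced prefix; a clique
   is then determined by the order of its edges at that place together with its
   profile, i.e. the word telling which vertex of its edge each vertex is, so
   |W_k| <= (C k)^k.

   For the lower bounds cut every segment of [rn] corresponding to a block of the
   composition into m pieces.  An edge has type (x, y) if it uses the x-th pieces
   where P and Q agree and the y-th ones where they are opposite; edges whose types
   have pairwise distinct x's and pairwise distinct y's form a clique.  If there is
   no such family of size m/4, then all edges avoid the types outside some few rows
   and columns, an event of probability at most 8^(-m), and there are at most 4^m
   choices of rows and columns.

   If three edges pairwise form P, reading their word from the left shows that it
   consists of blocks a^t b^t c^t, so that P is collectable; hence R(3, 3) = 6
   bounds the cliques of two non-collectable patterns. *)

Require Import Defs.
From HB Require Import structures.
From mathcomp Require Import all_boot all_order all_fingroup all_algebra.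
From mathcomp Require Import reals exp zify.
Set Implicit Arguments. Unset Strict Implicit. Unset Printing Implicit Defensive.
Import Order.TTheory GRing.Theory Num.Theory.

(** * Counting inequalities *)

(** [N ^ N] is at most the falling factorial of [2N] with [N] factors, which is [N!] times a central
    binomial coefficient, and that is at most [2 ^ (2N)]. *)
Lemma expn_self_le_fact N : N ^ N <= 4 ^ N * N`!.
Proof.
have le_ffact k : k <= N -> N ^ k <= (N + N) ^_ k.
  elim: k => [|k IH] // lkN; rewrite expnSr ffactnSr.
  by apply: leq_mul; [apply: IH; lia | lia].
apply: (leq_trans (le_ffact N (leqnn N))).
rewrite -bin_ffact leq_mul2r; apply/orP; right.
have -> : 4 ^ N = (1 + 1) ^ (N + N) by rewrite (addnn N) -mul2n expnM.
rewrite expnDn.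
have hN : N < (N + N).+1 by lia.
rewrite (bigD1 (Ordinal hN)) //= !exp1n !muln1; exact: leq_addr.
Qed.

(** Multiplied out to avoid division and subtraction: [N] random values from [[L]] collide with
    probability at most [N ^ 2 / L]. *)
Lemma ffact_ge L N : L ^ N.+1 <= L * L ^_ N + N ^ 2 * L ^ N.
Proof.
elim: N => [|N IH]; first by rewrite ffactn0 muln1 expn1; lia.
rewrite ffactnSr.
have [leNL|ltLN] := leqP N L; last first.
  have -> : L - N = 0 by lia.
  rewrite !muln0 add0n (expnS L N.+1) leq_mul2r; apply/orP; right.
  by rewrite -mulnn; nia.
move: IH; rewrite !(expnS L) -!mulnn; set X := L ^ N; set F := L ^_ N => IH.
have := leq_mul IH (leqnn (L - N)).
have : N * N * (L * X) <= N * N * (L * X) by [].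
nia.
Qed.

Lemma half_le_ffact L N : 2 * N ^ 2 <= L -> L ^ N <= 2 * L ^_ N.
Proof.
case: L => [|L] hL.
  by have -> : N = 0 by (case: N hL => // N; rewrite -mulnn; lia).
have := ffact_ge L.+1 N; rewrite expnS => h.
rewrite -(leq_pmul2l (ltn0Sn L)).
have := leq_mul hL (leqnn (L.+1 ^ N)).
nia.
Qed.

Lemma bernoulli_nat T F N : T * T ^ N + N * F * T ^ N <= T * (T + F) ^ N.
Proof.
elim: N => [|N IH]; first by rewrite !expn0; lia.
rewrite !expnS; set X := T ^ N in IH *; set Y := (T + F) ^ N in IH *.
have := leq_mul IH (leqnn (T + F)); nia.
Qed.

Lemma leq_expnl a b n : a <= b -> a ^ n <= b ^ n.
Proof. by case: n => // n h; rewrite leq_exp2r. Qed.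

Lemma expn_sub_le T F n : F <= T -> (T - F) ^ n * (T + F) ^ n <= T ^ n * T ^ n.
Proof. by move=> leFT; rewrite -!expnMn; apply: leq_expnl; nia. Qed.

(** Divided by powers of [T]: [(1 - F/T)^n <= 8^(-m)]. Since [(1 - x)(1 + x) <= 1], it is enough
    that [(1 + F/T)^N >= 1 + N F/T >= 1 + 7], by Bernoulli. *)
Lemma expn_sub_exp_decay T F N m n :
  0 < T -> F <= T -> 7 * T <= N * F -> N * m <= n -> (T - F) ^ n * 8 ^ m <= T ^ n.
Proof.
move=> T0 leFT hN hn.
have step : 8 * T ^ N <= (T + F) ^ N.
  rewrite -(leq_pmul2l T0); apply: leq_trans (bernoulli_nat T F N).
  have := leq_mul hN (leqnn (T ^ N)); nia.
have pow : 8 ^ m * T ^ n <= (T + F) ^ n.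
  rewrite -(subnK hn) !expnD !expnM mulnCA.
  apply: leq_mul; first by apply: leq_expnl; apply: leq_addr.
  by rewrite -expnMn; apply: leq_expnl.
have Tn0 : 0 < T ^ n by rewrite expn_gt0 T0.
rewrite -(leq_pmul2r Tn0); apply: leq_trans (expn_sub_le n leFT).
by rewrite -mulnA leq_mul2l pow orbT.
Qed.

(** The same argument with [F = 1] and Bernoulli applied to the whole exponent:
    [(1 - 1/T)^n <= T / (T + n)], enough when [T] is fixed. *)
Lemma expn_sub_hyp_decay T n :
  0 < T -> (T - 1) ^ n * (T + n) <= T * T ^ n.
Proof.
move=> T0; have Tn0 : 0 < T ^ n by rewrite expn_gt0 T0.
rewrite -(leq_pmul2r Tn0) -mulnA.
apply: (@leq_trans ((T - 1) ^ n * (T * (T + 1) ^ n))).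
  rewrite leq_mul2l; apply/orP; right.
  by apply: leq_trans (bernoulli_nat T 1 n); rewrite muln1 mulnDl.
by rewrite mulnCA -mulnA leq_mul2l expn_sub_le ?orbT.
Qed.

(** * The random value model *)

Section Model.
Variables (r n L : nat).
Implicit Types (g : {ffun 'I_n * 'I_r -> 'I_L}) (M : lmatching r n).

Definition vrank g (v : 'I_n * 'I_r) : nat := #|[set u | g u < g v]|.

Lemma vrank_lt g v : vrank g v < r * n.
Proof.
have -> : r * n = #|{: 'I_n * 'I_r}| by rewrite card_prod !card_ord mulnC.
rewrite -cardsT; apply: proper_card; rewrite properE subsetT /=.
by apply/subsetPn; exists v; rewrite ?inE // ltnn.
Qed.

(** Equal values get equal ranks, so this is a bijection onto the positions only for injective
    [g]. *)
Definition orank g v : 'I_(r * n) := Ordinal (vrank_lt g v).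

(* M lists the labels of the vertices in increasing order of their values g. *)
Definition reads g M := [forall v : 'I_n * 'I_r, M (orank g v) == v.1].

Lemma readsP g M : reflect (forall v, M (orank g v) = v.1) (reads g M).
Proof. by apply: (iffP forallP) => h v; apply/eqP; apply: h. Qed.

Lemma orank_mono g u v : (orank g u < orank g v) = (g u < g v).
Proof.
have le_rank a b : g a <= g b -> vrank g a <= vrank g b.
  move=> le_ab; apply: subset_leq_card; apply/subsetP=> x; rewrite !inE => lt_xa.
  exact: leq_trans lt_xa le_ab.
rewrite /=; case: (ltnP (g u) (g v)) => [lt_uv|le_vu]; last first.
  by apply/negbTE; rewrite -leqNgt le_rank.
apply: proper_card; apply/properP; split.
  by apply/subsetP=> x; rewrite !inE => lt_xa; apply: ltn_trans lt_uv.
by exists u; rewrite !inE ?ltnn.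
Qed.

Lemma orank_inj g : injective g -> injective (orank g).
Proof.
move=> inj_g u v eq_uv; apply: inj_g; apply: val_inj.
have huv := orank_mono g u v; have hvu := orank_mono g v u.
rewrite eq_uv ltnn in huv; rewrite eq_uv ltnn in hvu.
by case: ltngtP huv hvu.
Qed.

Lemma orank_bij g : injective g -> bijective (orank g).
Proof.
move=> inj_g; apply: inj_card_bij; first exact: orank_inj.
by rewrite card_prod !card_ord mulnC.
Qed.

Lemma reads_valid g M : injective g -> reads g M -> valid_matching M.
Proof.
move=> inj_g /readsP rM; apply/forallP=> e.
have [h hK Kh] := orank_bij inj_g.
have -> : [set i | M i == e] = [set orank g (e, a) | a in 'I_r].
  apply/setP=> i; rewrite inE; apply/eqP/imsetP => [Mi|[a _ ->]]; last exact: rM.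
  exists (h i).2 => //; rewrite -{1}(Kh i); congr orank.
  by move: (rM (h i)); rewrite Kh Mi => ->; case: (h i).
by rewrite card_imset ?card_ord // => a b /(orank_inj inj_g) [].
Qed.

Lemma reads_ex g : injective g -> exists M, reads g M.
Proof.
move=> inj_g; have [h hK Kh] := orank_bij inj_g.
by exists [ffun i => (h i).1]; apply/readsP=> v; rewrite ffunE hK.
Qed.

Lemma reads_uniq g M M' : injective g -> reads g M -> reads g M' -> M = M'.
Proof.
move=> inj_g /readsP rM /readsP rM'; have [h hK Kh] := orank_bij inj_g.
by apply/ffunP=> i; rewrite -(Kh i) rM rM'.
Qed.

Definition wordM M : seq 'I_n := [seq M i | i <- enum 'I_(r * n)].

Lemma count_wordM_card M e : count_mem e (wordM M) = #|[set i | M i == e]|.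
Proof.
rewrite -sum1_card -sum1_count big_map big_enum_cond.
by apply: eq_bigl => i; rewrite inE.
Qed.

Lemma count_wordM M e : valid_matching M -> count_mem e (wordM M) = r.
Proof. by rewrite count_wordM_card => /forallP/(_ e)/eqP. Qed.

Lemma size_wordM M : size (wordM M) = r * n.
Proof. by rewrite size_map size_enum_ord. Qed.

(** Both words are arrangements of the multiset that contains each label [r] times. *)
Lemma valid_matching_perm M M' : valid_matching M -> valid_matching M' ->
  exists p : {perm 'I_(r * n)}, forall i, M' i = M (p i).
Proof.
move=> vM vM'; have : perm_eq (wordM M') [tuple M i | i < r * n].
  apply/allP=> e _ /=; have -> : map M (enum 'I_(r * n)) = wordM M by [].
  by rewrite !count_wordM.
case/tuple_permP=> p eqp; exists p => i.
have := congr1 (fun s => nth (M' i) s i) eqp.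
rewrite (nth_map i) ?size_enum_ord // nth_ord_enum => ->.
rewrite -[X in nth _ X _]/(tval [tuple tnth [tuple M i | i < r * n] (p i) | i < r * n]).
by rewrite -tnth_nth !tnth_mktuple.
Qed.

Definition readers M : {set {ffun 'I_n * 'I_r -> 'I_L}} :=
  [set g : {ffun 'I_n * 'I_r -> 'I_L} | injectiveb g && reads g M].

Lemma readers_le M M' : valid_matching M -> valid_matching M' ->
  #|readers M| <= #|readers M'|.
Proof.
move=> vM vM'; have [p pE] := valid_matching_perm vM vM'.
(* Permuting the vertices by the conjugate of p under the rank map turns a
   reader of M into a reader of M', and does not change the set of values. *)
pose sh g v := odflt v [pick u | orank g u == (p^-1)%g (orank g v)].
have shE g v : injective g -> orank g (sh g v) = (p^-1)%g (orank g v).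
  move=> inj_g; rewrite /sh; case: pickP => [u /eqP //|no].
  have [h hK Kh] := orank_bij inj_g.
  by have := no (h ((p^-1)%g (orank g v))); rewrite Kh eqxx.
have sh_inj g : injective g -> injective (sh g).
  move=> inj_g u v eq_sh; apply: (orank_inj inj_g).
  by apply: (@perm_inj _ (p^-1)%g); rewrite -!shE // eq_sh.
pose F g := [ffun v => g (sh g v)].
have rankF g v : injective g -> orank (F g) v = (p^-1)%g (orank g v).
  move=> inj_g; rewrite -shE //; apply: val_inj => /=; rewrite /vrank.
  have -> : [set u | F g u < F g v] = sh g @^-1: [set u | g u < g (sh g v)].
    by apply/setP=> u; rewrite !inE !ffunE.
  by apply: card_preimset; apply: sh_inj.
have F_inj g : injective g -> injective (F g).
  by move=> inj_g u v; rewrite !ffunE => /inj_g /(sh_inj _ inj_g).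
have FF_inj : {in readers M &, injective F}.
  move=> g1 g2; rewrite !inE => /andP[/injectiveP i1 _] /andP[/injectiveP i2 _] eqF.
  have eq_rank v : orank g1 v = orank g2 v.
    by apply: (@perm_inj _ (p^-1)%g); rewrite -!rankF // eqF.
  have eq_sh v : sh g1 v = sh g2 v.
    by apply: (orank_inj i1); rewrite shE // [RHS]eq_rank shE // eq_rank.
  have [k kK Kk] : bijective (sh g1) by apply: inj_card_bij (sh_inj _ i1) _.
  apply/ffunP=> v; have := congr1 (fun f : {ffun _} => f (k v)) eqF.
  by rewrite !ffunE -eq_sh Kk.
rewrite -(card_in_imset FF_inj); apply: subset_leq_card.
apply/subsetP=> _ /imsetP[g + ->]; rewrite inE => /andP[/injectiveP inj_g /readsP rM].
rewrite inE; apply/andP; split; first by apply/injectiveP; apply: F_inj.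
by apply/readsP=> v; rewrite pE rankF // permKV rM.
Qed.

Lemma readers_eq M M' : valid_matching M -> valid_matching M' ->
  #|readers M| = #|readers M'|.
Proof. by move=> vM vM'; apply/eqP; rewrite eqn_leq !readers_le. Qed.

(** Any injection reads some valid matching; as all valid matchings have equally many readers, [M]
    has one as well. *)
Lemma readers_ex M : r * n <= L -> valid_matching M -> exists g, g \in readers M.
Proof.
move=> leL vM.
have lt_rank (v : 'I_n * 'I_r) : enum_rank v < L.
  by apply: leq_trans leL; rewrite mulnC -[n in n * r]card_ord -[r in _ * r]card_ord -card_prod.
pose g : {ffun 'I_n * 'I_r -> 'I_L} := [ffun v => Ordinal (lt_rank v)].
have inj_g : injective g.
  by move=> u v; rewrite !ffunE => -[] /val_inj /enum_rank_inj.
have [M' rM'] := reads_ex inj_g.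
have : 0 < #|readers M|.
  rewrite (readers_eq vM (reads_valid inj_g rM')); apply/card_gt0P; exists g.
  by rewrite inE rM' andbT; apply/injectiveP.
by case/card_gt0P => x; exists x.
Qed.

Lemma readers_disjoint M M' g : g \in readers M -> g \in readers M' -> M = M'.
Proof.
by rewrite !inE => /andP[/injectiveP inj rM] /andP[_ rM']; apply: reads_uniq rM rM'.
Qed.

Lemma card_bigcup_readers (X : {set lmatching r n}) :
  #|\bigcup_(M in X) readers M| = \sum_(M in X) #|readers M|.
Proof.
pose F g M := (M \in X) && (g \in readers M).
rewrite -sum1_card.
under [RHS]eq_bigr do rewrite -sum1_card.
rewrite (exchange_big_dep (fun g => g \in \bigcup_(M in X) readers M)) /=; last first.
  by move=> M g MX gM; apply/bigcupP; exists M.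
apply: eq_bigr => g /bigcupP[M MX gM].
rewrite (big_pred1 M) // => M'; apply/andP/eqP => [[_ gM']|-> //].
exact: readers_disjoint gM' gM.
Qed.

(* A random injection from the vertices to [L] induces the uniform distribution
   on matchings, and for L >= 2(rn)^2 at least half of all maps are injective. *)
Lemma card_bad_matchings (X : {set lmatching r n}) (B : {set {ffun 'I_n * 'I_r -> 'I_L}}) :
  2 * (r * n) ^ 2 <= L -> (forall M, M \in X -> valid_matching M) ->
  (forall g M, injective g -> M \in X -> reads g M -> g \in B) ->
  #|X| * L ^ (r * n) <= 2 * #|B| * #|[set M : lmatching r n | valid_matching M]|.
Proof.
move=> leL vX XB; set V := [set M | _].
have [->|[M0 M0X]] := set_0Vmem X; first by rewrite cards0.
have vM0 := vX _ M0X; set b := #|readers M0|.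
have cardX : #|X| * b <= #|B|.
  rewrite -sum_nat_const -(eq_bigr _ (fun M MX => readers_eq (vX _ MX) vM0)).
  rewrite -card_bigcup_readers; apply: subset_leq_card; apply/subsetP=> g.
  case/bigcupP=> M MX; rewrite inE => /andP[/injectiveP inj rM]; exact: XB rM.
have cardV : L ^ (r * n) <= 2 * (#|V| * b).
  apply: leq_trans (half_le_ffact leL) _; rewrite leq_mul2l /=.
  have -> : L ^_ (r * n) = #|[set g : {ffun 'I_n * 'I_r -> 'I_L} | injectiveb g]|.
    by rewrite card_inj_ffuns card_prod !card_ord mulnC.
  rewrite -sum_nat_const -(eq_bigr _ (fun M MX => readers_eq (_ : valid_matching M) vM0)); last first.
    by move=> M; rewrite inE.
  rewrite -card_bigcup_readers; apply: subset_leq_card; apply/subsetP=> g.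
  rewrite inE => /injectiveP inj; have [M rM] := reads_ex inj.
  apply/bigcupP; exists M; first by rewrite inE; apply: reads_valid rM.
  by rewrite inE rM andbT; apply/injectiveP.
have b0 : 0 < b.
  have [|g gM] := @readers_ex M0 _ vM0; last by apply/card_gt0P; exists g.
  by apply: leq_trans leL; rewrite -mulnn; nia.
rewrite -(leq_pmul2r b0).
have := leq_mul cardX cardV; nia.
Qed.

End Model.

(** * Pair words *)

Definition norm (s : seq bool) : seq bool := [seq b != head false s | b <- s].

(* The word induced by the letters e (written false) and f (written true). *)
Definition lw (T : eqType) (w : seq T) (e f : T) : seq bool :=
  [seq x == f | x <- w & (x == e) || (x == f)].

Lemma pair_wordE r n (M : lmatching r n) (e f : 'I_n) : e != f ->
  pair_word M e f = norm (lw (wordM M) e f).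
Proof.
move=> neq_ef; rewrite /pair_word /norm /lw /wordM (filter_map M).
set t := [seq i <- enum _ | (M i == e) || (M i == f)].
rewrite -!map_comp; have : all (fun i => (M i == e) || (M i == f)) t by apply: filter_all.
case: t => [|i0 t] //= /andP[h0 ht].
have key i : (M i == e) || (M i == f) -> (M i != M i0) = ((M i == f) != (M i0 == f)).
  by case/orP: h0 => /eqP -> /orP[] /eqP ->; rewrite ?eqxx ?(negbTE neq_ef) // eq_sym.
rewrite key //; congr cons; apply/eq_in_map => i it.
by rewrite /= key // (allP ht).
Qed.

(** * Merging the values of two edges *)

Definition labord (p q : nat * bool) := (p.1 < q.1) || ((p.1 == q.1) && (p.2 <= q.2)).

Lemma labord_trans : transitive labord.
Proof. by move=> [y b] [x a] [z c]; rewrite /labord /=; case: a; case: b; case: c; rewrite ?andbT ?andbF; lia. Qed.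

Lemma labord_anti : antisymmetric labord.
Proof.
move=> [x a] [y b]; rewrite /labord /= => h.
have eq_xy : x = y by lia.
by move: h; rewrite eq_xy ltnn eqxx; case: a; case: b.
Qed.

Lemma labord_total : total labord.
Proof. by move=> [x a] [y b]; rewrite /labord /=; case: a; case: b; rewrite ?andbT ?andbF; lia. Qed.

Definition labelled (s1 s2 : seq nat) : seq (nat * bool) :=
  [seq (x, false) | x <- s1] ++ [seq (x, true) | x <- s2].

Definition lab s1 s2 := sort labord (labelled s1 s2).

Lemma lab_eq s s1 s2 :
  sorted ltn (map fst s) -> perm_eq s (labelled s1 s2) -> lab s1 s2 = s.
Proof.
move=> sorted_s perm_s; apply: (sorted_eq labord_trans labord_anti).
- exact: (sort_sorted labord_total).
- rewrite sorted_map in sorted_s; apply: sub_sorted sorted_s => p q /=.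
  by rewrite /labord => ->.
- by rewrite perm_sort perm_sym.
Qed.

(** A monotone map without collisions keeps the relative order of all values. It is applied to the
    map from a value to its cell. *)
Lemma lab_map (phi : nat -> nat) s1 s2 :
  {homo phi : x y / x <= y} -> uniq (map phi (s1 ++ s2)) ->
  map snd (lab (map phi s1) (map phi s2)) = map snd (lab s1 s2).
Proof.
move=> mono_phi uniq_phi; pose F (p : nat * bool) := (phi p.1, p.2).
have -> : lab (map phi s1) (map phi s2) = map F (lab s1 s2).
  have permF : perm_eq (map F (lab s1 s2)) (labelled (map phi s1) (map phi s2)).
    rewrite (perm_trans (_ : perm_eq _ (map F (labelled s1 s2)))) //.
      by apply: perm_map; rewrite perm_sort.
    by rewrite /labelled map_cat -!map_comp.
  apply: lab_eq => //; rewrite ltn_sorted_uniq_leq; apply/andP; split.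
    rewrite (perm_uniq (perm_map fst permF)) /labelled map_cat -!map_comp.
    by rewrite (eq_map (_ : _ =1 phi)) // (eq_map (_ : _ =1 phi)) // -map_cat.
  rewrite -map_comp (eq_map (_ : _ =1 phi \o fst)) // map_comp.
  rewrite sorted_map; apply: sub_sorted (_ : sorted leq _).
    by move=> x y /=; apply: mono_phi.
  rewrite sorted_map; apply: sub_sorted (sort_sorted labord_total _).
  by move=> p q; rewrite /labord /=; lia.
by rewrite -map_comp.
Qed.

Section Reading.
Variables (r n L : nat).
Implicit Types (g : {ffun 'I_n * 'I_r -> 'I_L}) (M : lmatching r n).

Definition row g e : seq nat := [seq (g (e, a) : nat) | a <- enum 'I_r].

Lemma reads_word g M : injective g -> reads g M ->
  exists t : seq ('I_n * 'I_r), [/\ sorted ltn [seq (g v : nat) | v <- t],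
    uniq t, forall v, v \in t & wordM M = map fst t].
Proof.
move=> inj_g /readsP rM; have [h hK Kh] := orank_bij inj_g.
exists [seq h i | i <- enum 'I_(r * n)]; split.
- have : sorted ltn (map val (enum 'I_(r * n))) by rewrite val_enum_ord iota_ltn_sorted.
  rewrite !sorted_map; apply: sub_sorted => i j /=.
  by rewrite -orank_mono !Kh.
- by rewrite map_inj_uniq ?enum_uniq //; apply: can_inj Kh.
- by move=> v; apply/mapP; exists (orank g v); rewrite ?mem_enum ?hK.
- by rewrite -map_comp; apply: eq_map => i /=; rewrite -{1}(Kh i) rM.
Qed.

(** The word of a pair depends on the values of its two edges alone; this permits restricting [g] to
    a few edges and replacing values by cells. *)
Lemma reads_lw g M e f : injective g -> reads g M -> e != f ->
  lw (wordM M) e f = map snd (lab (row g e) (row g f)).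
Proof.
move=> inj_g rM neq_ef; have [t [sorted_t uniq_t mem_t ->]] := reads_word inj_g rM.
rewrite /lw filter_map -map_comp; set t' := filter _ _.
pose F (v : 'I_n * 'I_r) := (g v : nat, v.1 == f).
rewrite (@lab_eq (map F t')) -?map_comp //.
  rewrite (eq_map (_ : _ =1 (fun v => g v : nat))) //.
  apply: (subseq_sorted ltn_trans) sorted_t; apply: map_subseq; exact: filter_subseq.
pose u := [seq (e, a) | a <- enum 'I_r] ++ [seq (f, a) | a <- enum 'I_r].
have -> : labelled (row g e) (row g f) = map F u.
  rewrite /labelled /u map_cat -!map_comp; congr (_ ++ _).
    by apply: eq_map => a; rewrite /F /= (negbTE neq_ef).
  by apply: eq_map => a; rewrite /F /= eqxx.
apply: perm_map; apply: uniq_perm.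
- exact: filter_uniq.
- have inj_pair (x : 'I_n) : injective (fun a : 'I_r => (x, a)) by move=> a b [].
  rewrite cat_uniq !(map_inj_uniq (inj_pair _)) !enum_uniq andbT /=.
  by apply/hasPn => _ /mapP[a _ ->]; apply/mapP => -[b _ []] /eqP; rewrite eq_sym (negbTE neq_ef).
- move=> [x a]; rewrite mem_filter mem_t andbT mem_cat /=.
  have memP y : ((x, a) \in [seq (y, a) | a <- enum 'I_r]) = (x == y).
    apply/mapP/eqP => [[b _ [-> _]] //|->]; by exists a; rewrite ?mem_enum.
  by rewrite !memP.
Qed.

End Reading.

Lemma lw_pair_word r n (M : lmatching r n) n' (M' : lmatching r n') e f e' f' :
  e != f -> e' != f' -> lw (wordM M) e f = lw (wordM M') e' f' ->
  pair_word M e f = pair_word M' e' f'.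
Proof. by move=> neq neq' eq_lw; rewrite !pair_wordE // eq_lw. Qed.

(** * Cliques determined by their layers and profile *)

Section Annotation.
Variable T : eqType.
Implicit Types (w u v : seq T) (c : T -> nat).

(* Every letter is annotated with c plus the number of its previous
   occurrences. *)
Fixpoint annot c w : seq (T * nat) :=
  if w is x :: w' then (x, c x) :: annot (fun y => (y == x) + c y) w' else [::].

(** Occurrences are numbered from 0. In the word of a matching, [trunc p] deletes the first [p]
    vertices of every edge, and [layer p] lists the edges in the order of their [(p + 1)]-st
    vertices. *)
Definition trunc p w := [seq z <- annot (fun=> 0) w | p <= z.2].
Definition layer p w := [seq z.1 | z <- annot (fun=> 0) w & z.2 == p].
Definition profile w := [seq z.2 | z <- annot (fun=> 0) w].

Lemma annot_fst c w : map fst (annot c w) = w.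
Proof. by elim: w c => //= x w IH c; rewrite IH. Qed.

Lemma eq_annot c1 c2 w : c1 =1 c2 -> annot c1 w = annot c2 w.
Proof.
by elim: w c1 c2 => //= x w IH c1 c2 eq_c; rewrite eq_c; congr cons; apply: IH => y; rewrite eq_c.
Qed.

Lemma annot_cat c u v :
  annot c (u ++ v) = annot c u ++ annot (fun y => count_mem y u + c y) v.
Proof.
elim: u c => //= x u IH c; congr cons; rewrite IH; congr cat.
by apply: eq_annot => y; rewrite eq_sym; lia.
Qed.

Lemma annot_lt c w z : z \in annot c w -> c z.1 <= z.2 < c z.1 + count_mem z.1 w.
Proof.
elim: w c => //= x w IH c; rewrite inE => /predU1P[->|/IH] /=.
  by rewrite eqxx; lia.
by rewrite eq_sym; lia.
Qed.

Lemma count_annot c w x p :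
  count_mem (x, p) (annot c w) = (c x <= p < c x + count_mem x w) :> nat.
Proof.
elim: w c => [|y w IH] c /=; first by rewrite addn0; lia.
by rewrite IH xpair_eqE (eq_sym x y); case: (y =P x) => [->|_] /=; lia.
Qed.

Lemma count_layer w x p : count_mem x (layer p w) = (p < count_mem x w) :> nat.
Proof.
have := count_annot (fun=> 0) w x p; rewrite !add0n /= => <-.
rewrite /layer count_map count_filter; apply: eq_count => -[y q] /=.
by rewrite xpair_eqE.
Qed.

Lemma layer_trunc p w : layer p w = [seq z.1 | z <- trunc p w & z.2 == p].
Proof.
rewrite /layer /trunc -filter_predI; congr map; apply: eq_filter => z /=.
by rewrite andb_idr // => /eqP ->.
Qed.

(** Such a prefix holds the first [p] occurrences of every letter and nothing else. *)
Lemma trunc_cat p u v : (forall x, count_mem x u = p) ->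
  trunc p (u ++ v) = annot (fun=> p) v.
Proof.
move=> cu; rewrite /trunc annot_cat filter_cat.
rewrite (eq_in_filter (_ : {in _, _ =1 pred0})) ?filter_pred0 /=; last first.
  by move=> z /annot_lt; rewrite cu /=; lia.
rewrite (eq_annot _ (c2 := fun=> p)); last by move=> x; rewrite cu addn0.
by apply/all_filterP/allP=> z /annot_lt /andP[].
Qed.

Lemma first_diff (s1 s2 : seq T) : size s1 = size s2 -> s1 <> s2 ->
  exists u x y t1 t2, [/\ s1 = u ++ x :: t1, s2 = u ++ y :: t2 & x != y].
Proof.
elim: s1 s2 => [|x s1 IH] [|y s2] //= [eq_size] neq.
have [eq_xy|neq_xy] := eqVneq x y; last by exists [::], x, y, s1, s2.
have [|u [x' [y' [t1 [t2 [-> -> neq']]]]]] := IH s2 eq_size.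
  by move=> eq_s; apply: neq; rewrite eq_xy eq_s.
by exists (x :: u), x', y', t1, t2; rewrite eq_xy.
Qed.

Lemma first_diff_uniq u1 u2 (x1 x2 y1 y2 : T) s1 s2 t1 t2 :
  u1 ++ x1 :: s1 = u2 ++ x2 :: s2 -> u1 ++ y1 :: t1 = u2 ++ y2 :: t2 ->
  x1 != y1 -> x2 != y2 -> u1 = u2.
Proof.
elim: u1 u2 => [|a u1 IH] [|b u2] //=.
- by move=> [-> _] [-> _]; rewrite eqxx.
- by move=> [-> _] [-> _] _; rewrite eqxx.
- by move=> [-> e1] [e2] n1 n2; rewrite (IH u2 e1 e2 n1 n2).
Qed.

End Annotation.

Definition plw (T : eqType) (s : seq (T * nat)) (i j : T) : seq (bool * nat) :=
  [seq (z.1 == j, z.2) | z <- s & (z.1 == i) || (z.1 == j)].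

(** The number attached to a letter counts only occurrences of that letter, so it survives the
    deletion of the others. General start values [c] and [d] make the induction work. *)
Lemma annot_lw (T : eqType) (w : seq T) i j (c : T -> nat) (d : bool -> nat) :
  i != j -> d false = c i -> d true = c j -> annot d (lw w i j) = plw (annot c w) i j.
Proof.
move=> neq; rewrite /lw /plw; elim: w c d => //= x w IH c d ci cj.
have ji : (j == i) = false by rewrite eq_sym (negbTE neq).
have [->|nxi] := eqVneq x i => /=.
  rewrite (negbTE neq) ci; congr cons; apply: IH => /=; first by rewrite eqxx ci.
  by rewrite ji cj.
have [->|nxj] := eqVneq x j => /=.
  rewrite eqxx cj; congr cons; apply: IH => /=; last by rewrite eqxx cj.
  by rewrite (negbTE neq) ci.
by apply: IH; rewrite eq_sym ?(negbTE nxi) ?(negbTE nxj).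
Qed.

Lemma trunc_lw (T : eqType) (w : seq T) i j p : i != j ->
  trunc p (lw w i j) = plw (trunc p w) i j.
Proof.
move=> neq; rewrite /trunc (@annot_lw _ w i j (fun=> 0)) // /plw filter_map.
by congr map; rewrite -!filter_predI; apply: eq_filter => z /=; rewrite andbC.
Qed.

Lemma layer_lw (T : eqType) (w : seq T) i j p : i != j ->
  layer p (lw w i j) = lw (layer p w) i j.
Proof.
move=> neq; rewrite /layer (@annot_lw _ w i j (fun=> 0)) // /plw /lw !filter_map.
rewrite -!map_comp; congr map; rewrite -!filter_predI.
by apply: eq_filter => z /=; rewrite andbC.
Qed.

Lemma lw_cat (T : eqType) (u v : seq T) i j : lw (u ++ v) i j = lw u i j ++ lw v i j.
Proof. by rewrite /lw filter_cat map_cat. Qed.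

(** If the words first differ by having [x] and [y] at the same place, then their words for the pair
    [x], [y] differ. *)
Lemma lw_inj (T : eqType) (w1 w2 : seq T) : size w1 = size w2 ->
  (forall i j, i != j -> lw w1 i j = lw w2 i j) -> w1 = w2.
Proof.
move=> eq_size eq_lw; have [//|/eqP neq] := eqVneq w1 w2.
have [u [x [y [t1 [t2 [e1 e2 neq_xy]]]]]] := first_diff eq_size neq.
have := eq_lw _ _ neq_xy; rewrite e1 e2 !lw_cat => /eqP; rewrite eqseq_cat // eqxx /=.
by rewrite /lw /= !eqxx orbT /= eqxx (negbTE neq_xy) => /eqP [].
Qed.

Lemma norm_flip (s : seq bool) : map (addb (head false s)) (norm s) = s.
Proof.
by rewrite /norm -map_comp -[RHS]map_id; apply: eq_map => b /=; case: b; case: head.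
Qed.

Lemma flipK h : involutive (map (addb h)).
Proof. by move=> s; rewrite -map_comp -[RHS]map_id; apply: eq_map => b /=; rewrite addKb. Qed.

Lemma norm_map h (s : seq bool) : norm (map (addb h) s) = norm s.
Proof.
case: s => // b s; rewrite /norm /= -!map_comp; congr cons; first by case: h; case: b.
by apply: eq_map => x /=; case: h; case: b; case: x.
Qed.

Lemma norm_head (s : seq bool) : head false (norm s) = false.
Proof. by case: s => //= b s; case: b. Qed.

Lemma norm_id (s : seq bool) : head false s = false -> norm s = s.
Proof. by move=> hs; rewrite -{2}(norm_flip s) hs map_id. Qed.

Lemma count_flip h b (u : seq bool) : count_mem b (map (addb h) u) = count_mem (addb h b) u.
Proof. by rewrite count_map; apply: eq_count => x /=; case: h; case: b; case: x. Qed.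

Definition balanced p (u : seq bool) := forall b, count_mem b u = p.

Lemma balanced_flip h p u : balanced p u -> balanced p (map (addb h) u).
Proof. by move=> bu b; rewrite count_flip. Qed.

Definition PQ_word (P Q : seq bool) (T : eqType) (w : seq T) :=
  forall i j, i != j -> norm (lw w i j) = P \/ norm (lw w i j) = Q.

Lemma layer_flip h p (s : seq bool) : layer p (map (addb h) s) = map (addb h) (layer p s).
Proof.
have key c (w : seq bool) : annot c (map (addb h) w)
    = [seq (addb h z.1, z.2) | z <- annot (c \o addb h) w].
  elim: w c => //= x w IH c; congr cons; rewrite IH; congr map.
  by apply: eq_annot => y /=; rewrite {IH}; case: h; case: x; case: y.
by rewrite /layer key filter_map -!map_comp.
Qed.

Lemma layer_balanced p U b Y : balanced p U -> exists Z, layer p (U ++ b :: Y) = b :: Z.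
Proof.
by move=> bU; rewrite layer_trunc trunc_cat //= eqxx /=; eexists.
Qed.

Lemma head_layer0 (s : seq bool) : head false (layer 0 s) = head false s.
Proof. by case: s. Qed.

(** For each pair, layer 0 tells which edge comes first, and layer [p] tells which edge follows the
    balanced prefix [U], hence whether the pattern is [P] or [Q]. So all pair words are
    determined. *)
Lemma PQ_word_layers_inj P Q p U b Y Z (T : eqType) (w1 w2 : seq T) :
  P = U ++ b :: Y -> Q = U ++ ~~ b :: Z -> balanced p U ->
  PQ_word P Q w1 -> PQ_word P Q w2 -> size w1 = size w2 ->
  layer 0 w1 = layer 0 w2 -> layer p w1 = layer p w2 -> w1 = w2.
Proof.
move=> eP eQ bU cl1 cl2 eq_size eq0 eqp; apply: lw_inj => // i j neq.
rewrite -(norm_flip (lw w1 i j)) -(norm_flip (lw w2 i j)).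
have eq_head : head false (lw w1 i j) = head false (lw w2 i j).
  by rewrite -(head_layer0 (lw w1 i j)) -(head_layer0 (lw w2 i j)) !layer_lw // eq0.
have : layer p (norm (lw w1 i j)) = layer p (norm (lw w2 i j)).
  have : layer p (lw w1 i j) = layer p (lw w2 i j) by rewrite !layer_lw // eqp.
  rewrite -{1}(norm_flip (lw w1 i j)) -{1}(norm_flip (lw w2 i j)) !layer_flip eq_head.
  exact: (can_inj (flipK _)).
have [V1 hP] := layer_balanced b Y bU; have [V2 hQ] := layer_balanced (~~ b) Z bU.
rewrite -eP in hP; rewrite -eQ in hQ.
rewrite eq_head; case: (cl1 _ _ neq) => ->; case: (cl2 _ _ neq) => -> //.
  by rewrite hP hQ => -[]; case: (b).
by rewrite hP hQ => -[]; case: (b).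
Qed.

(* The mismatch condition without reference to blocks: see
   mismatch_splits_apart. *)
Inductive splits_apart (p : nat) (P Q : seq bool) : Prop :=
  SplitsApart U V P' Q' u c X Y of P = U ++ P' & Q = V ++ Q' &
    balanced p U & balanced p V &
    norm P' = u ++ c :: X & norm Q' = u ++ ~~ c :: Y &
    count_mem true u <> count_mem false u.

Lemma splits_apart_sym p P Q : splits_apart p P Q -> splits_apart p Q P.
Proof.
case=> U V P' Q' u c X Y eP eQ bU bV eP' eQ' unb.
by apply: (SplitsApart eQ eP bV bU (c := ~~ c) eQ' _ unb); rewrite negbK; exact: eP'.
Qed.

Section SplitsApart.
Variables (p : nat) (P Q U V P' Q' u : seq bool) (c : bool) (X Y : seq bool).
Hypotheses (eP : P = U ++ P') (eQ : Q = V ++ Q').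
Hypotheses (bU : balanced p U) (bV : balanced p V).
Hypotheses (eP' : norm P' = u ++ c :: X) (eQ' : norm Q' = u ++ ~~ c :: Y).
Hypothesis unbalanced_u : count_mem true u <> count_mem false u.
Variables (T : eqType).
Implicit Types w : seq T.

Lemma norm_neq : norm P' <> norm Q'.
Proof. by rewrite eP' eQ' => /eqP; rewrite eqseq_cat // eqxx /= => /eqP[]; case: c. Qed.

(** Here [h] is the orientation of the pair and [k] says whether its pattern is [P]. Deleting [p]
    vertices of each edge cuts off exactly the balanced prefix [U] or [V]. *)
Lemma PQ_word_tail w i j : PQ_word P Q w -> i != j ->
  exists h (k : bool), [/\ lw w i j = map (addb h) (if k then P else Q),
    trunc p (lw w i j) = annot (fun=> p) (map (addb h) (if k then P' else Q')) &
    (if k then P' else Q') <> [::]].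
Proof.
move=> cl neq; pose h := head false (lw w i j).
have nP : P' <> [::] by move=> e; move: eP'; rewrite e /norm; case: (u).
have nQ : Q' <> [::] by move=> e; move: eQ'; rewrite e /norm; case: (u).
exists h; case: (cl _ _ neq) => e.
  exists true; split => //; first by rewrite -e norm_flip.
  by rewrite -(norm_flip (lw w i j)) e eP map_cat trunc_cat //; apply: balanced_flip.
exists false; split => //; first by rewrite -e norm_flip.
by rewrite -(norm_flip (lw w i j)) e eQ map_cat trunc_cat //; apply: balanced_flip.
Qed.

Lemma norm_tails (k1 k2 : bool) :
  norm (if k1 then P' else Q') = norm (if k2 then P' else Q') -> k1 = k2.
Proof. by case: k1; case: k2 => // h; case: norm_neq. Qed.

(** At the first difference of the truncated words, equal profiles force the same occurrence number
    [q] on two edges [i] and [j]. The tails of this pair then part after a balanced prefix, whereas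
    those of [P] and [Q] part after the unbalanced [u]. *)
Lemma PQ_word_trunc_inj w1 w2 : PQ_word P Q w1 -> PQ_word P Q w2 ->
  profile w1 = profile w2 -> layer p w1 = layer p w2 -> trunc p w1 = trunc p w2.
Proof.
move=> cl1 cl2 eq_prof eq_layer.
have prof_trunc w : map snd (trunc p w) = [seq q <- profile w | p <= q].
  by rewrite /profile filter_map.
have eq_snd : map snd (trunc p w1) = map snd (trunc p w2) by rewrite !prof_trunc eq_prof.
have eq_size : size (trunc p w1) = size (trunc p w2).
  by rewrite -(size_map snd) eq_snd size_map.
have [//|/eqP neq] := eqVneq (trunc p w1) (trunc p w2).
have [v [[i q] [[j q'] [t1 [t2 [e1 e2 neq_ij]]]]]] := first_diff eq_size neq.
have eq_q : q = q'.
  move: eq_snd; rewrite e1 e2 !map_cat => /eqP; rewrite eqseq_cat // eqxx /=.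
  by move=> /eqP[].
move: neq_ij e2; rewrite -eq_q xpair_eqE eqxx andbT => neq_ij e2 {eq_q q'}.
have [eq_qp|neq_qp] := eqVneq q p.
  move: eq_layer; rewrite !layer_trunc e1 e2 !filter_cat !map_cat /= eq_qp eqxx /=.
  move/eqP; rewrite eqseq_cat // eqxx /= => /eqP[] eq_ij.
  by rewrite eq_ij eqxx in neq_ij.
have [h1 [k1 [_ tr1 ne1]]] := PQ_word_tail cl1 neq_ij.
have [h2 [k2 [_ tr2 ne2]]] := PQ_word_tail cl2 neq_ij.
(* Layer [p] decides which of [i], [j] begins the truncated pair word, so both tails have the same
   orientation. *)
have heads : head false (layer p (lw w1 i j)) = head false (layer p (lw w2 i j)).
  by rewrite !layer_lw // eq_layer.
rewrite !layer_trunc tr1 tr2 in heads.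
set Y1 := map _ _ in tr1 heads; set Y2 := map _ _ in tr2 heads.
have norm1 : norm Y1 = norm (if k1 then P' else Q') by rewrite norm_map.
have norm2 : norm Y2 = norm (if k2 then P' else Q') by rewrite norm_map.
have headE (s : seq bool) :
    head false [seq z.1 | z <- annot (fun=> p) s & z.2 == p] = head false s.
  by case: s => //= x s; rewrite eqxx.
rewrite !headE in heads.
have tl1 : annot (fun=> p) Y1 = plw v i j ++ (false, q) :: plw t1 i j.
  rewrite -tr1 trunc_lw // e1 /plw filter_cat map_cat /= eqxx /=.
  by rewrite (negbTE neq_ij).
have tl2 : annot (fun=> p) Y2 = plw v i j ++ (true, q) :: plw t2 i j.
  by rewrite -tr2 trunc_lw // e2 /plw filter_cat map_cat /= eqxx orbT /= eqxx.
set v' := map fst (plw v i j).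
have y1 : Y1 = v' ++ false :: map fst (plw t1 i j).
  by rewrite -(annot_fst (fun=> p) Y1) tl1 map_cat.
have y2 : Y2 = v' ++ true :: map fst (plw t2 i j).
  by rewrite -(annot_fst (fun=> p) Y2) tl2 map_cat.
(* The next letter after [v'] is [i] with number [q] in [w1] and [j] with number [q] in [w2], so
   [v'] contains each letter [q - p] times. *)
have cnt b : count_mem b v' + p = q.
  have eqa1 := tl1; have eqa2 := tl2; rewrite y1 annot_cat in eqa1; rewrite y2 annot_cat in eqa2.
  have sz : size (annot (fun=> p) v') = size (plw v i j).
    by rewrite -(size_map fst) annot_fst /v' size_map.
  move/eqP: eqa1; rewrite eqseq_cat // => /andP[_ /eqP /= [cf _]].
  move/eqP: eqa2; rewrite eqseq_cat // => /andP[_ /eqP /= [ct _]].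
  by case: b.
have eq12 : norm Y1 = map (addb (head false Y1)) v' ++ addb (head false Y1) false
              :: map (addb (head false Y1)) (map fst (plw t1 i j)).
  by rewrite -[norm Y1](flipK (head false Y1)) norm_flip {2}y1 map_cat.
have eq22 : norm Y2 = map (addb (head false Y1)) v' ++ addb (head false Y1) true
              :: map (addb (head false Y1)) (map fst (plw t2 i j)).
  by rewrite heads -[norm Y2](flipK (head false Y2)) norm_flip {2}y2 map_cat.
have neq_head h : addb h false != addb h true by case: h.
have neq_c : c != ~~ c by case: c.
(* The tails differ under a common orientation, so one is that of [P] and the other that of [Q]; the
   place of the first difference is unique. *)
have u_eq : u = map (addb (head false Y1)) v'.
  rewrite norm1 in eq12; rewrite norm2 in eq22.
  have neq12 : k1 <> k2.
    move=> ek; move: eq12; rewrite ek eq22 => /eqP; rewrite eqseq_cat // eqxx /=.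
    by move=> /eqP[]; case: (head false Y1).
  move: eq12 eq22; case: (k1) (k2) neq12 => [] [] // _.
    rewrite eP' eQ' => a1 a2; exact: first_diff_uniq a1 a2 neq_c (neq_head _).
  rewrite eP' eQ' => a1 a2; apply: first_diff_uniq a2 a1 neq_c _.
  by rewrite eq_sym neq_head.
case: unbalanced_u; rewrite u_eq !count_flip.
by apply: (@addIn p); rewrite !cnt.
Qed.

(** The tail of a pair word identifies its pattern, since the normalised tails of [P] and [Q]
    differ, and its orientation, since it is not empty. So equal truncations give equal words for
    all pairs. *)
Lemma PQ_word_profile_inj w1 w2 : PQ_word P Q w1 -> PQ_word P Q w2 ->
  size w1 = size w2 -> profile w1 = profile w2 -> layer p w1 = layer p w2 -> w1 = w2.
Proof.
move=> cl1 cl2 eq_size eq_prof eq_layer.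
have eq_trunc := PQ_word_trunc_inj cl1 cl2 eq_prof eq_layer.
apply: lw_inj => // i j neq.
have [h1 [k1 [l1 tr1 ne1]]] := PQ_word_tail cl1 neq.
have [h2 [k2 [l2 tr2 ne2]]] := PQ_word_tail cl2 neq.
rewrite l1 l2.
have : map (addb h1) (if k1 then P' else Q') = map (addb h2) (if k2 then P' else Q').
  have : trunc p (lw w1 i j) = trunc p (lw w2 i j) by rewrite !trunc_lw // eq_trunc.
  by rewrite tr1 tr2 => /(congr1 (map fst)); rewrite !annot_fst.
move=> eq_map; have : k1 = k2.
  by apply: norm_tails; rewrite -(norm_map h1) eq_map norm_map.
move=> ek; move: ne1 eq_map; rewrite ek.
by case: (if k2 then P' else Q') => // b s _ [/addIb -> _].
Qed.

End SplitsApart.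

(** * Block decompositions *)

Definition flip_blocks h (bs : seq (bool * nat)) := [seq (addb h bt.1, bt.2) | bt <- bs].

Lemma block_decomp_flip h P bs :
  block_decomp P bs -> block_decomp (map (addb h) P) (flip_blocks h bs).
Proof.
case=> pos_bs ->; split; first by rewrite all_map.
rewrite map_flatten /flip_blocks -!map_comp; congr flatten; apply: eq_map => -[b t] /=.
by rewrite map_cat !map_nseq addbN.
Qed.

Lemma flip_blocks_sizes h bs : map snd (flip_blocks h bs) = map snd bs.
Proof. by rewrite -map_comp. Qed.

Lemma block_decomp_cons P b t bs : block_decomp P ((b, t) :: bs) ->
  exists2 P1, P = nseq t b ++ nseq t (~~ b) ++ P1 & 0 < t /\ block_decomp P1 bs.
Proof.
by case=> /= /andP[t0 pos_bs] ->; rewrite -catA; eexists; last split; first reflexivity.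
Qed.

Lemma block_decomp_cat P1 P2 bs1 bs2 :
  block_decomp P1 bs1 -> block_decomp P2 bs2 -> block_decomp (P1 ++ P2) (bs1 ++ bs2).
Proof. by move=> [a1 ->] [a2 ->]; split; rewrite ?all_cat ?a1 // map_cat flatten_cat. Qed.

Lemma balanced_size p u : balanced p u -> size u = 2 * p.
Proof.
move=> bu; rewrite -(count_predC (pred1 true)).
rewrite (eq_count (_ : predC (pred1 true) =1 pred1 false)); last by case.
by rewrite !bu; lia.
Qed.

(** A prefix that ends strictly inside a block has too many letters of the first half of this block,
    so a balanced prefix ends between two blocks. *)
Lemma block_decomp_split p u v bs : balanced p u -> block_decomp (u ++ v) bs ->
  exists bs1 bs2, [/\ bs = bs1 ++ bs2, block_decomp u bs1 & block_decomp v bs2].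
Proof.
elim: bs p u => [|[b t] bs IH] p u bu.
  by case=> _; case: u bu => // _ /= ->; exists [::], [::].
have [->|u_nil] := eqVneq u [::]; first by exists [::], ((b, t) :: bs).
case/block_decomp_cons=> P1 eP [t0 dP1].
have size_u := balanced_size bu.
have p0 : 0 < p by case: (u) size_u u_nil => //=; lia.
have take_u : u = take (2 * p) (nseq t b ++ nseq t (~~ b) ++ P1).
  by rewrite -eP -size_u take_size_cat.
(* Otherwise [u], of length [2p], would end inside the first block and contain more letters [b] than
   [~~ b]. *)
have letP : t <= p.
  rewrite leqNgt; apply/negP=> ltpt; have := bu (~~ b); have := bu b.
  rewrite take_u take_cat size_nseq.
  case: ltnP => h.
    have -> : take (2 * p) (nseq t b) = nseq (2 * p) b by rewrite take_nseq //; lia.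
    by rewrite !count_nseq /= eqxx; case: (b) => /=; lia.
  rewrite take_cat size_nseq (_ : _ < t); last by lia.
  rewrite take_nseq; last by lia.
  by rewrite !count_cat !count_nseq /= !eqxx; case: (b) => /=; lia.
have [u' eu] : exists u', u = nseq t b ++ nseq t (~~ b) ++ u'.
  exists (take (2 * p - t - t) P1); rewrite {1}take_u take_cat size_nseq ltnNge (_ : t <= 2 * p) /=; last by lia.
  by rewrite take_cat size_nseq ltnNge (_ : t <= 2 * p - t) //=; lia.
have bu' : balanced (p - t) u'.
  move=> x; have := bu x; rewrite eu !count_cat !count_nseq /=.
  by case: (x) (b) => [] [] /=; lia.
have eP1 : P1 = u' ++ v.
  move: eP; rewrite eu -!catA => /eqP; rewrite eqseq_cat // eqxx /= eqseq_cat // eqxx /=.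
  by move=> /eqP.
rewrite eP1 in dP1; have [bs1 [bs2 [-> d1 d2]]] := IH _ _ bu' dP1.
exists ((b, t) :: bs1), bs2; split => //.
case: d1 => pos1 e1; split; first by rewrite /= t0.
by rewrite eu /= -catA -e1.
Qed.

Definition transfers P Q := forall bs, block_decomp P bs ->
  exists2 bs', block_decomp Q bs' & map snd bs' = map snd bs.

(** Induction on the length. If the normalised words agree, blocks transfer up to a flip. Otherwise
    let [u] be their common prefix: an unbalanced [u] splits the words apart, and a balanced one is
    removed from both, which respects blocks by [block_decomp_split]. *)
Lemma splits_apart_or_transfers P Q : (exists p, balanced p P /\ balanced p Q) ->
  (exists p, splits_apart p P Q) \/ transfers P Q.
Proof.
have [N] := ubnP (size P); elim: N P Q => // N IH P Q ltN [p [bP bQ]].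
have eq_size : size P = size Q by rewrite (balanced_size bP) (balanced_size bQ).
have eq_size' : size (norm P) = size (norm Q) by rewrite !size_map.
have [eq_norm|/eqP neq] := eqVneq (norm P) (norm Q).
  right=> bs dP; exists (flip_blocks (head false Q) (flip_blocks (head false P) bs)).
    rewrite -{1}(norm_flip Q) -eq_norm; apply: block_decomp_flip.
    have -> : norm P = map (addb (head false P)) P by rewrite -{3}(norm_flip P) flipK.
    exact: block_decomp_flip.
  by rewrite !flip_blocks_sizes.
have [u [c [d [X [Y [eX eY neq_cd]]]]]] := first_diff eq_size' neq.
have ed : d = ~~ c by case: c d neq_cd {eX eY} => [] [].
rewrite ed in eY.
have [eq_count|neq_count] := eqVneq (count_mem true u) (count_mem false u); last first.
  left; exists 0; apply: (@SplitsApart _ _ _ [::] [::] P Q u c X Y) => //.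
  exact/eqP.
set q := count_mem true u in eq_count.
have bu : balanced q u by case.
(* Normalised words start alike, so removing [u] shortens the words. *)
have u_nil : u <> [::].
  move=> eu; have := norm_head P; have := norm_head Q; rewrite eX eY eu /= => cE.
  by rewrite -[c]negbK cE.
pose hP := head false P; pose hQ := head false Q.
have eP : P = map (addb hP) u ++ map (addb hP) (c :: X) by rewrite -map_cat -eX norm_flip.
have eQ : Q = map (addb hQ) u ++ map (addb hQ) (~~ c :: Y) by rewrite -map_cat -eY norm_flip.
move: eP eQ; set P1 := map _ (c :: X); set Q1 := map _ (~~ c :: Y) => eP eQ.
have buP := balanced_flip hP bu; have buQ := balanced_flip hQ bu.
have lt_size : size P1 < N.
  by move: ltN; rewrite eP size_cat size_map; case: (u) u_nil => //= *; lia.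
have [|[p' sp]|tr] := IH P1 Q1 lt_size.
- exists (p - q); split => x.
    by have := bP x; rewrite eP count_cat buP; lia.
  by have := bQ x; rewrite eQ count_cat buQ; lia.
- left; exists (q + p'); case: sp => U V P' Q' w c' X' Y' eP1 eQ1 bU bV e1 e2 unb.
  apply: (@SplitsApart _ _ _ (map (addb hP) u ++ U) (map (addb hQ) u ++ V) P' Q' w c' X' Y') => //.
  + by rewrite -catA -eP1.
  + by rewrite -catA -eQ1.
  + by move=> x; rewrite count_cat buP bU.
  + by move=> x; rewrite count_cat buQ bV.
right=> bs; rewrite eP => /(block_decomp_split buP)[bs1 [bs2 [-> d1 d2]]].
have [bs2' d2' s2] := tr _ d2.
exists (flip_blocks hQ (flip_blocks hP bs1) ++ bs2'); last first.
  by rewrite !map_cat !flip_blocks_sizes s2.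
rewrite eQ; apply: block_decomp_cat => //; apply: block_decomp_flip.
by rewrite -(flipK hP u); apply: block_decomp_flip.
Qed.

Lemma is_pattern_balanced r P : is_pattern r P -> balanced r P.
Proof.
case/and3P=> /eqP size_P /eqP count_P _ b.
have count_true : count_mem true P = r.
  by rewrite -count_P; apply: eq_count; case.
have := count_predC (pred1 true) P.
rewrite (eq_count (_ : predC (pred1 true) =1 pred1 false)); last by case.
by rewrite count_true size_P; case: b; lia.
Qed.

Lemma mismatch_splits_apart r P Q : is_pattern r P -> is_pattern r Q ->
  mismatch P Q -> exists p, splits_apart p P Q.
Proof.
move=> /is_pattern_balanced bP /is_pattern_balanced bQ.
case=> [[[bs dP] ncQ]|[[ncP [bs dQ]]|[[bs dP] [_ neq]]]].
- have [//|tr] := @splits_apart_or_transfers P Q (ex_intro _ r (conj bP bQ)).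
  by have [bs' dQ _] := tr _ dP; case: ncQ; exists bs'.
- have [[p sp]|tr] := @splits_apart_or_transfers Q P (ex_intro _ r (conj bQ bP)).
    by exists p; apply: splits_apart_sym.
  by have [bs' dP _] := tr _ dQ; case: ncP; exists bs'.
- have [//|tr] := @splits_apart_or_transfers P Q (ex_intro _ r (conj bP bQ)).
  by have [bs' dQ eq_s] := tr _ dP; case: (neq _ _ dP dQ).
Qed.

(** The blocks before the first one of different direction coincide and form the balanced prefix
    [U]. *)
Lemma harmonious_split P Q : harmonious P Q ->
  exists p U b Y Z, [/\ P = U ++ b :: Y, Q = U ++ ~~ b :: Z & balanced p U].
Proof.
case=> neq [bsP [bsQ [dP [dQ eq_s]]]].
elim: bsP bsQ P Q neq dP dQ eq_s => [|[b t] bsP IH] [|[b' t'] bsQ] P Q neq //.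
  by move=> [_ eP] [_ eQ]; case: neq; rewrite eP eQ.
move=> /block_decomp_cons[P1 eP [t0 dP]] /block_decomp_cons[Q1 eQ [_ dQ]] [et es].
rewrite -et in eQ; have [eb|nb] := eqVneq b b'.
  have neq1 : P1 <> Q1 by move=> e; case: neq; rewrite eP eQ eb e.
  have [p [U [c [Y [Z [e1 e2 bU]]]]]] := IH bsQ P1 Q1 neq1 dP dQ es.
  exists (t + p), (nseq t b ++ nseq t (~~ b) ++ U), c, Y, Z.
  rewrite eP eQ -eb e1 e2 -!catA; split => // x.
  by rewrite !count_cat !count_nseq bU /=; case: (x) (b) => [] [] /=; lia.
have eb : b' = ~~ b by case: b b' nb {eP eQ} => [] [].
case: t t0 eP eQ {et} => // t _ eP eQ.
exists 0, [::], b, (nseq t b ++ nseq t.+1 (~~ b) ++ P1), (nseq t (~~ b) ++ nseq t.+1 (~~ ~~ b) ++ Q1).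
by rewrite eP eQ eb.
Qed.

(** * Cliques of non-collectable patterns *)

Lemma lw_sym (T : eqType) (w : seq T) i j : i != j ->
  lw w j i = map (addb true) (lw w i j).
Proof.
move=> neq; rewrite /lw -map_comp (eq_filter (_ : _ =1 (fun x => (x == i) || (x == j)))); last first.
  by move=> x; rewrite orbC.
apply/eq_in_map => x; rewrite mem_filter => /andP[/orP[] /eqP -> _] /=.
  by rewrite eqxx (negbTE neq).
by rewrite eqxx eq_sym (negbTE neq).
Qed.

Lemma split_first (T : eqType) (w : seq T) c : c \in w ->
  exists u v, w = u ++ c :: v /\ c \notin u.
Proof.
elim: w => // x w IH; rewrite inE; have [->|neq] := eqVneq c x.
  by exists [::], w.
by case/IH=> u [v [-> nu]]; exists (x :: u), v; rewrite inE negb_or neq nu.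
Qed.

Lemma lw_notin (T : eqType) (u : seq T) a c : a != c -> c \notin u ->
  lw u a c = nseq (count_mem a u) false.
Proof.
move=> neq; elim: u => //= x u IH; rewrite inE negb_or => /andP[ncx /IH eu].
rewrite /lw /= (eq_sym x c) (negbTE ncx) orbF; case: eqP => _ /=; rewrite -eu //.
by rewrite (eq_sym x c) (negbTE ncx).
Qed.

Lemma count_lw (T : eqType) (u : seq T) a b : a != b ->
  (count_mem false (lw u a b) = count_mem a u) *
  (count_mem true (lw u a b) = count_mem b u).
Proof.
move=> neq; rewrite /lw; split; rewrite count_map count_filter; apply: eq_count => x /=.
  case: (x =P b) => [->|_]; last by rewrite orbF andTb.
  by rewrite (eq_sym b a) (negbTE neq).
by case: (x =P b) => [_|_]; rewrite ?orbT.
Qed.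

(** Until [s] letters [c] are read, no [a] or [b] can occur, as it would show up as [false] in its
    word with [c]. Thus the part of [v] read so far is invisible to the pair [a], [b]. *)
Lemma lw_eat (T : eqType) (v : seq T) a b c s P : a != b -> a != c -> b != c ->
  lw v a c = nseq s true ++ P -> lw v b c = nseq s true ++ P ->
  exists v', [/\ lw v' a c = P, lw v' b c = P & lw v' a b = lw v a b].
Proof.
move=> nab nac nbc; elim: v s => [|x v IH] [|s]; try by move=> *; exists [::].
  by move=> ha hb; exists (x :: v).
have [->|nxa] := eqVneq x a; first by rewrite /lw /= eqxx /= (negbTE nac).
have [->|nxb] := eqVneq x b; first by rewrite /lw /= eqxx /= (negbTE nbc).
have eab : lw (x :: v) a b = lw v a b by rewrite /lw /= (negbTE nxa) (negbTE nxb).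
rewrite eab; have [->|nxc] := eqVneq x c.
  rewrite /lw /= eqxx !orbT /= eqxx => -[ha] [hb]; exact: IH ha hb.
rewrite /lw /= (negbTE nxa) (negbTE nxb) (negbTE nxc) /= => ha hb.
exact: (IH s.+1).
Qed.

(* Reading up to the first c sees exactly t letters a and t letters b; the
   a's come first because of {a, b} and then {a, c} forces t letters c. *)
Lemma strip_block (T : eqType) (w : seq T) a b c P : a != b -> a != c -> b != c ->
  lw w a b = false :: P -> lw w a c = false :: P -> lw w b c = false :: P ->
  exists t v P', [/\ 0 < t, false :: P = nseq t false ++ nseq t true ++ P',
    lw v a b = P', lw v a c = P' & lw v b c = P'].
Proof.
move=> nab nac nbc wab wac wbc.
have lw_mem x y : x != y -> (y \in w) = (true \in lw w x y).
  by move=> neq; rewrite -!has_pred1 !has_count (count_lw w neq).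
have bw : b \in w.
  have := (count_lw w nbc).1; rewrite wbc /= => e.
  by rewrite -has_pred1 has_count -e.
have cw : c \in w by rewrite (lw_mem _ _ nac) wac -wab -(lw_mem _ _ nab).
have [u [v [ew ncu]]] := split_first cw.
have pac : false :: P = nseq (count_mem a u) false ++ true :: lw v a c.
  by rewrite -wac ew lw_cat lw_notin // /lw /= eqxx orbT /= eqxx.
have pbc : false :: P = nseq (count_mem b u) false ++ true :: lw v b c.
  by rewrite -wbc ew lw_cat lw_notin // /lw /= eqxx orbT /= eqxx.
have idx s (X : seq bool) : index true (nseq s false ++ true :: X) = s.
  by elim: s => //= s ->.
have eq_t : count_mem a u = count_mem b u by rewrite -(idx (count_mem a u) (lw v a c)) -pac pbc idx.
set t := count_mem a u in pac eq_t.
rewrite -eq_t in pbc.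
have [cf ct] := count_lw u nab; rewrite -/t in cf; rewrite -eq_t -/t in ct.
have size_u : size (lw u a b) = t + t.
  rewrite -(count_predC (pred1 true)) ct; congr (_ + _); rewrite -[RHS]cf.
  by apply: eq_count; case.
have pab : false :: P = lw u a b ++ lw v a b.
  rewrite -wab ew lw_cat; congr cat; rewrite /lw /= eq_sym (negbTE nac) eq_sym.
  by rewrite (negbTE nbc).
(* The first [t] letters are those of the pattern, which begins with [t] times [false] by [pac]; the
   other [t] letters must then all be [true]. *)
have eu : lw u a b = nseq t false ++ nseq t true.
  have e0 : take t (lw u a b) = nseq t false.
    have := congr1 (take t) pab; rewrite {1}pac take_size_cat ?size_nseq // => ->.
    by rewrite takel_cat // size_u leq_addr.
  rewrite -(cat_take_drop t (lw u a b)) e0; congr cat.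
  have cd : count_mem true (drop t (lw u a b)) = t.
    by rewrite -[RHS]ct -{2}(cat_take_drop t (lw u a b)) e0 count_cat count_nseq.
  have size_d : size (drop t (lw u a b)) = t by rewrite size_drop size_u addnK.
  by rewrite -[in RHS]size_d; apply/all_pred1P; rewrite all_count cd size_d.
have t0 : 0 < t by move: pac; case: (t).
(* Two factorisations of the pattern are compared; one of the [t] letters [c] has already been read,
   whence [t.-1]. *)
have tail X : false :: P = nseq t false ++ true :: X -> X = nseq t.-1 true ++ lw v a b.
  move=> e; have := pab; rewrite eu e -catA => /eqP; rewrite eqseq_cat // eqxx /= => /eqP.
  by rewrite -{1}(prednK t0) /= => -[].
have [v' [e1 e2 e3]] := lw_eat nab nac nbc (tail _ pac) (tail _ pbc).
by exists t, v', (lw v a b); split; rewrite // pab eu -catA.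
Qed.

Lemma collectable_cons t P : 0 < t -> collectable P ->
  collectable (nseq t false ++ nseq t true ++ P).
Proof.
move=> t0 [bs [pos ->]]; exists ((false, t) :: bs); split; first by rewrite /= t0.
by rewrite /= -catA.
Qed.

Lemma collectable_flip h P : collectable (map (addb h) P) -> collectable P.
Proof.
case=> bs d; exists (flip_blocks h bs).
by rewrite -(flipK h P); apply: block_decomp_flip.
Qed.

(** [strip_block] removes one block at a time. A remainder that starts with [true] is brought into
    the required form by reversing the order of [a], [b], [c], which flips all three words. *)
Lemma mono_triangle (T : eqType) (w : seq T) a b c P : a != b -> a != c -> b != c ->
  lw w a b = P -> lw w a c = P -> lw w b c = P -> collectable P.
Proof.
have [N] := ubnP (size P); elim: N w a b c P => // N IH w a b c.
have strip_case (x y z : T) P : size P < N.+1 -> x != y -> x != z -> y != z ->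
    head true P = false -> lw w x y = P -> lw w x z = P -> lw w y z = P -> collectable P.
  case: P => // -[] // P lt_size nxy nxz nyz _ xy xz yz.
  have [t [v [P' [t0 eP v1 v2 v3]]]] := strip_block nxy nxz nyz xy xz yz.
  rewrite eP; apply: collectable_cons => //.
  apply: (IH v x y z) => //; move: lt_size; have := congr1 size eP.
  by rewrite !size_cat !size_nseq /=; lia.
case=> [|[] P] lt_size nab nac nbc wab wac wbc; first by exists [::].
  apply: (@collectable_flip true); apply: (strip_case c b a); rewrite ?size_map //.
  - by rewrite eq_sym.
  - by rewrite eq_sym.
  - by rewrite eq_sym.
  - by rewrite -wbc -lw_sym.
  - by rewrite -wac -lw_sym.
  - by rewrite -wab -lw_sym.
by apply: (strip_case a b c).
Qed.

(** The first of [i], [j], [k] to occur would have to be preceded by another one. *)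
Lemma lw_no_cycle (T : eqType) (w : seq T) i j k P : i != j -> j != k -> k != i ->
  lw w i j = false :: P -> lw w j k = false :: P -> lw w k i = false :: P -> False.
Proof.
move=> nij njk nki; elim: w => // x w IH.
have [->|nxi] := eqVneq x i; first by rewrite /lw /= eqxx orbT /= eqxx.
have [->|nxj] := eqVneq x j; first by rewrite /lw /= eqxx orbT /= eqxx.
have [->|nxk] := eqVneq x k; first by rewrite /lw /= eqxx orbT /= eqxx.
by rewrite /lw /= (negbTE nxi) (negbTE nxj) (negbTE nxk).
Qed.

(** Orient each pair by which letter occurs first. Two of the eight orientations are cyclic and
    impossible; the others order the three letters so that all pair words equal the pattern. *)
Lemma unordered_triangle (T : eqType) (w : seq T) i j k P : head true P = false ->
  i != j -> i != k -> j != k ->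
  norm (lw w i j) = P -> norm (lw w i k) = P -> norm (lw w j k) = P -> collectable P.
Proof.
case: P => // -[] // P _ nij nik njk.
have orient x y : x != y -> norm (lw w x y) = false :: P ->
    lw w x y = false :: P \/ lw w y x = false :: P.
  move=> nxy e; have := norm_flip (lw w x y); rewrite e (lw_sym w nxy).
  case: (head _ _) => <-; [right; exact: (flipK true (false :: P)) | left].
  by rewrite (eq_map (_ : _ =1 id)) ?map_id.
have nji : j != i by rewrite eq_sym.
have nki : k != i by rewrite eq_sym.
have nkj : k != j by rewrite eq_sym.
move=> /(orient _ _ nij) [] ij /(orient _ _ nik) [] ik /(orient _ _ njk) [] jk.
- exact: (mono_triangle _ _ _ ij ik jk).
- exact: (mono_triangle _ _ _ ik ij jk).
- by case: (lw_no_cycle nij njk nki ij jk ik).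
- exact: (mono_triangle _ _ _ ik jk ij).
- exact: (mono_triangle _ _ _ ij jk ik).
- by case: (lw_no_cycle nik nkj nji ik jk ij).
- exact: (mono_triangle _ _ _ jk ij ik).
- exact: (mono_triangle _ _ _ jk ik ij).
Qed.

(** Three of the edges at [x0] have one colour [b]; either [b] occurs among their other ends, or
    these form a triangle of the other colour. *)
Lemma ramsey33 (T : eqType) (col : T -> T -> bool) (s : seq T) :
  (forall x y, col x y = col y x) -> uniq s -> 6 <= size s ->
  exists b x y z, [/\ x != y, x != z, y != z & [/\ col x y = b, col x z = b & col y z = b]].
Proof.
move=> sym; case: s => // x0 s /= /andP[x0s us] size_s.
have [b] : exists b, 3 <= count (fun y => col x0 y == b) s.
  have := count_predC (fun y => col x0 y == true) s.
  rewrite (eq_count (_ : predC (fun y => col x0 y == true) =1 (fun y => col x0 y == false))).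
    case: (leqP 3 (count (fun y => col x0 y == true) s)) => [h|h1 h2]; first by exists true.
    by exists false; move: h1 h2; set m1 := count _ _; set m2 := count _ _; lia.
  by move=> y /=; case: (col _ _).
rewrite -size_filter; set t := filter _ s.
have ut : uniq t by apply: filter_uniq.
have mem_t y : y \in t -> (col x0 y == b) && (x0 != y).
  rewrite mem_filter => /andP[-> ys] /=; apply: contraNneq x0s => ->; exact: ys.
case: t ut mem_t => [|y1 [|y2 [|y3 t]]] // ut mem_t _.
have [/andP[/eqP c1 n1] /andP[/eqP c2 n2] /andP[/eqP c3 n3]] :
    [/\ (col x0 y1 == b) && (x0 != y1), (col x0 y2 == b) && (x0 != y2)
      & (col x0 y3 == b) && (x0 != y3)].
  by split; apply: mem_t; rewrite !inE eqxx ?orbT.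
have [n12 n13 n23] : [/\ y1 != y2, y1 != y3 & y2 != y3].
  by move: ut; rewrite /= !inE !negb_or => /and4P[/and3P[-> -> _] /andP[-> _] _ _].
have [e12|e12] := eqVneq (col y1 y2) b; first by exists b, x0, y1, y2.
have [e13|e13] := eqVneq (col y1 y3) b; first by exists b, x0, y1, y3.
have [e23|e23] := eqVneq (col y2 y3) b; first by exists b, x0, y2, y3.
exists (~~ b), y1, y2, y3; split => //.
by move: e12 e13 e23; case: (b); case: (col y1 y2); case: (col y1 y3); case: (col y2 y3).
Qed.

(** Pairs are coloured by whether they form [P]; a monochromatic triangle would make [P] or [Q]
    collectable. *)
Lemma noncollectable_clique_le5 r P Q n (M : lmatching r n) :
  is_pattern r P -> is_pattern r Q -> ~ collectable P -> ~ collectable Q ->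
  is_clique P Q M [set: 'I_n] -> n <= 5.
Proof.
move=> /and3P[_ _ /eqP hP] /and3P[_ _ /eqP hQ] nP nQ cl.
rewrite leqNgt; apply/negP=> lt5n.
pose col i j := norm (lw (wordM M) i j) == P.
have sym i j : col i j = col j i.
  by have [->//|neq] := eqVneq i j; rewrite /col (lw_sym _ neq) norm_map.
have [|b [x [y [z [nxy nxz nyz [cxy cxz cyz]]]]]] := @ramsey33 _ col (enum 'I_n) sym (enum_uniq _).
  by rewrite size_enum_ord.
have PQ i j : i != j -> norm (lw (wordM M) i j) = if col i j then P else Q.
  move=> neq; have /implyP/(_ neq) : (i != j) ==> forms_PQ P Q M i j.
    by move/forall_inP: cl => /(_ i (in_setT _)) /forall_inP /(_ j (in_setT _)).
  by rewrite /forms_PQ pair_wordE // /col; case: eqP => //= _ /eqP.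
have := unordered_triangle (w := wordM M) (P := if b then P else Q) _ nxy nxz nyz.
rewrite !PQ // cxy cxz cyz; case: (b) => h.
  by apply: nP; apply: h.
by apply: nQ; apply: h.
Qed.

(** * Upper bounds *)

Lemma prod_enum_fold (I : finType) (f : I -> nat) :
  foldr muln 1 [seq f x | x : I] = \prod_x f x.
Proof. by rewrite foldrE big_map big_enum. Qed.

(** A reader is determined by its set of values and its rank function, and a vertex of edge [e] can
    only have one of the [r] positions of [M] with label [e]. *)
Lemma card_readers r k L (M : lmatching r k) : valid_matching M ->
  #|readers L M| <= 'C(L, r * k) * r ^ (r * k).
Proof.
move=> vM; pose V : finType := ('I_k * 'I_r)%type.
have cardV : #|{: V}| = r * k by rewrite card_prod !card_ord mulnC.
pose Im (g : {ffun V -> 'I_L}) := g @: [set: 'I_k * 'I_r].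
pose F (g : {ffun V -> 'I_L}) := (Im g, [ffun v => orank g v]).
pose fam := [set f : {ffun V -> 'I_(r * k)} |
   f \in family (fun v => [pred i | M i == v.1])].
have card_fam : #|fam| = r ^ (r * k).
  rewrite cardsE card_family prod_enum_fold.
  transitivity (\prod_(v : V) r); last by rewrite prod_nat_const cardV.
  by apply: eq_bigr => v _; rewrite -[RHS](eqP (forallP vM v.1)) cardsE.
have F_inj : {in readers L M &, injective F}.
  move=> g h; rewrite !inE => /andP[/injectiveP ig _] /andP[/injectiveP ih _] [eIm eR].
  have card_below (g0 : {ffun V -> 'I_L}) (i0 : injective g0) v : vrank g0 v = #|[set x in Im g0 | x < g0 v]|.
    rewrite /vrank -(card_imset _ i0); congr #|pred_of_set _|; apply/setP=> x.
    apply/imsetP/setIdP => [[u + ->]|[/imsetP[u _ ->] lt]].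
      by rewrite inE => lt; split => //; apply: imset_f.
    by exists u; rewrite ?inE.
  have eq_rank v : vrank g v = vrank h v.
    by have := congr1 (fun f : {ffun V -> 'I_(r * k)} => val (f v)) eR; rewrite !ffunE.
  (* With equal images, a larger value has strictly more values below it, hence a larger rank. *)
  have le (g1 g2 : {ffun V -> 'I_L}) (i1 : injective g1) (i2 : injective g2) v : Im g1 = Im g2 ->
      vrank g1 v = vrank g2 v -> g1 v <= g2 v.
    move=> eI; rewrite (card_below _ i1) (card_below _ i2) eI => eR'.
    rewrite leqNgt; apply/negP=> lt.
    have : [set x in Im g2 | x < g2 v] \proper [set x in Im g2 | x < g1 v].
      apply/properP; split.
        apply/subsetP=> x; rewrite !inE => /andP[-> ltx] /=; exact: ltn_trans lt.
      exists (g2 v); first by apply/setIdP; split=> //; apply: imset_f; rewrite inE.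
      by rewrite inE ltnn andbF.
    by move/proper_card; rewrite eR' ltnn.
  apply/ffunP=> v; apply/val_inj/eqP; rewrite eqn_leq.
  by rewrite !le // ?eIm ?eq_rank.
rewrite -(card_in_imset F_inj) -card_fam -[L in 'C(L, _)]card_ord -card_draws -cardsX.
apply: subset_leq_card; apply/subsetP=> _ /imsetP[g + ->].
rewrite inE => /andP[/injectiveP ig /readsP rM]; apply/setXP; split.
  by rewrite inE card_imset // cardsT cardV.
by rewrite inE; apply/familyP=> v; rewrite ffunE inE /= rM.
Qed.

Lemma leq_card_bigcup (I T : finType) (P : pred I) (F : I -> {set T}) :
  #|\bigcup_(i | P i) F i| <= \sum_(i | P i) #|F i|.
Proof.
elim/big_rec2: _ => [|i s A _ IH]; first by rewrite cards0.
by rewrite cardsU; apply: leq_trans (leq_subr _ _) _; rewrite leq_add2l.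
Qed.

(** * Restriction to few edges and the first-moment bound *)

Section Restriction.
Variables (r n k L : nat) (t : k.-tuple 'I_n).
Hypothesis uniq_t : uniq t.
Implicit Types (g : {ffun 'I_n * 'I_r -> 'I_L}) (h : {ffun 'I_k * 'I_r -> 'I_L}).

Definition restr g : {ffun 'I_k * 'I_r -> 'I_L} := [ffun v => g (tnth t v.1, v.2)].

Lemma restr_inj g : injective g -> injective (restr g).
Proof.
move=> ig [i a] [j b]; rewrite !ffunE => /ig [] /= eq_t ->.
by have /tuple_uniqP inj_t := uniq_t; rewrite (inj_t _ _ eq_t).
Qed.

Lemma row_restr g i : row (restr g) i = row g (tnth t i).
Proof. by apply: eq_map => a; rewrite ffunE. Qed.

Lemma restr_pair_word g M M' i j : injective g -> reads g M -> reads (restr g) M' ->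
  i != j -> pair_word M' i j = pair_word M (tnth t i) (tnth t j).
Proof.
move=> ig rM rM' neq.
have neq' : tnth t i != tnth t j.
  by apply: contra neq => /eqP; have /tuple_uniqP inj_t := uniq_t => /inj_t ->.
apply: lw_pair_word => //; rewrite (reads_lw ig rM neq').
by rewrite (reads_lw (restr_inj ig) rM' neq) !row_restr.
Qed.

(** Only the [r * (n - k)] values at the edges outside [t] remain free. *)
Lemma card_restr_fiber h : #|[set g | restr g == h]| <= L ^ (r * (n - k)).
Proof.
pose Fam (v : 'I_n * 'I_r) := [pred x : 'I_L |
  [forall i, (tnth t i == v.1) ==> (x == h (i, v.2))]].
have cardF v : #|Fam v| <= if v.1 \in t then 1 else L.
  case: ifPn => [/tnthP[i ei]|_]; last by rewrite -[leqRHS]card_ord max_card.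
  rewrite -(card1 (h (i, v.2))); apply: subset_leq_card; apply/subsetP=> x.
  by rewrite !inE => /forallP/(_ i); rewrite -ei eqxx.
have -> : L ^ (r * (n - k)) = \prod_(v : 'I_n * 'I_r) (if v.1 \in t then 1 else L).
  rewrite -(pair_bigA _ (fun (e : 'I_n) (a : 'I_r) => if e \in t then 1 else L)) /=.
  under eq_bigr do rewrite prod_nat_const card_ord.
  rewrite (bigID (fun e => e \in t)) /= big1 ?mul1n; last by move=> e ->; rewrite exp1n.
  rewrite (eq_bigr (fun=> L ^ r)); last by move=> e /negbTE ->.
  rewrite prod_nat_const -expnM; congr (_ ^ (_ * _)).
  have := cardC (mem t); rewrite (card_uniqP uniq_t) size_tuple [RHS]card_ord => en.
  by rewrite -{1}en addKn; apply: eq_card => e; rewrite !inE.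
apply: leq_trans (leq_prod (fun v _ => cardF v)).
rewrite -prod_enum_fold -card_family; apply: subset_leq_card; apply/subsetP=> g.
rewrite inE => /eqP eh; apply/familyP=> v; rewrite inE; apply/forallP=> i.
by apply/implyP=> /eqP ei; rewrite -eh ffunE ei; case: (v).
Qed.

End Restriction.

Lemma is_cliqueP r n P Q (M : lmatching r n) (S : {set 'I_n}) :
  reflect (forall e f, e \in S -> f \in S -> e != f -> forms_PQ P Q M e f)
          (is_clique P Q M S).
Proof.
apply: (iffP forall_inP) => [h e f eS fS neq|h e eS].
  by have /forall_inP/(_ f fS)/implyP := h e eS; apply.
by apply/forall_inP=> f fS; apply/implyP; apply: h.
Qed.

Definition full_cliques r k P Q : {set lmatching r k} :=
  [set M | valid_matching M && is_clique P Q M [set: 'I_k]].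

Lemma sorted_tuple_uniq n k (t : k.-tuple 'I_n) :
  sorted ltn [seq val i | i <- t] -> uniq t.
Proof.
move=> st; apply: (@map_uniq _ _ val).
by apply: sorted_uniq st; [exact: ltn_trans | exact: ltnn].
Qed.

(** Sorting selects one tuple for each [k]-subset, so the union bound runs over ['C(n, k)]
    tuples. *)
Lemma clique_tuple r n P Q (M : lmatching r n) k : k <= zPQ P Q M ->
  exists t : k.-tuple 'I_n, sorted ltn [seq val i | i <- t] /\
   forall i j, i != j -> forms_PQ P Q M (tnth t i) (tnth t j).
Proof.
have cl0 : is_clique P Q M set0 by apply/is_cliqueP=> e f; rewrite inE.
rewrite /zPQ (bigop.bigmax_eq_arg set0) //; case: arg_maxnP => // S clS _ leS.
have size_t : size (take k (enum S)) == k by rewrite size_takel // -cardE.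
exists (Tuple size_t) => /=.
have sorted_S : sorted ltn [seq val i | i <- take k (enum S)].
  rewrite map_take; apply: take_sorted.
  have : subseq (map val (enum S)) (map val (enum 'I_n)).
    by apply: map_subseq; rewrite [enum 'I_n]enumT; apply: filter_subseq.
  move/subseq_sorted; apply; first exact: ltn_trans.
  by rewrite val_enum_ord iota_ltn_sorted.
have inS i : tnth (Tuple size_t) i \in S.
  have : tnth (Tuple size_t) i \in take k (enum S) := mem_tnth i (Tuple size_t).
  by move/mem_take; rewrite mem_enum.
split=> // i j neq; apply: (is_cliqueP _ _ _ _ clS) => //.
have /tuple_uniqP inj_t := @sorted_tuple_uniq n k (Tuple size_t) sorted_S.
by apply: contra neq => /eqP/inj_t ->.
Qed.

Lemma restr_full_clique r n k L P Q (g : {ffun 'I_n * 'I_r -> 'I_L}) (M : lmatching r n)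
    (t : k.-tuple 'I_n) : injective g -> reads g M -> uniq t ->
  (forall i j, i != j -> forms_PQ P Q M (tnth t i) (tnth t j)) ->
  exists2 M', M' \in full_cliques r k P Q & reads (restr t g) M'.
Proof.
move=> ig rM ut cl; have irg := restr_inj ut ig; have [M' rM'] := reads_ex irg.
exists M' => //; rewrite inE (reads_valid irg rM') /=.
apply/is_cliqueP=> i j _ _ neq; have := cl i j neq.
by rewrite /forms_PQ (restr_pair_word ut ig rM rM' neq).
Qed.

(** Union bound over the sorted tuples [t] and over the readers of the labelled cliques on [t]. The
    range [L] cancels, because ['C(L, rk) (rk)! <= L ^ (rk)]. *)
Lemma large_clique_count r n k P Q :
  #|[set M : lmatching r n | valid_matching M && (k <= zPQ P Q M)]| * (r * k)`!
  <= 2 * 'C(n, k) * #|full_cliques r k P Q| * r ^ (r * k) *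
     #|[set M : lmatching r n | valid_matching M]|.
Proof.
set X := [set M | _ && _]; set V := [set M | valid_matching M].
have [lenk|ltnk] := leqP k n; last first.
  have -> : X = set0; last by rewrite cards0.
  apply/setP=> M; rewrite !inE; apply/negP=> /andP[_ /clique_tuple [t [st _]]].
  have := card_uniqP (sorted_tuple_uniq st); rewrite size_tuple => et.
  have := max_card (mem t); rewrite et card_ord; lia.
(* The successor keeps [L] positive when [r * n = 0]. *)
pose L := (2 * (r * n) ^ 2).+1.
have L0 : 0 < L by [].
pose H := \bigcup_(M in full_cliques r k P Q) readers L M.
pose ST := [set t : k.-tuple 'I_n | sorted ltn [seq val i | i <- t]].
have ST_uniq t : t \in ST -> uniq t.
  by rewrite inE; apply: sorted_tuple_uniq.
pose B := \bigcup_(t in ST) \bigcup_(h in H) [set g : {ffun 'I_n * 'I_r -> 'I_L} | restr t g == h].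
have leX : #|X| * L ^ (r * n) <= 2 * #|B| * #|V|.
  apply: card_bad_matchings => [|M|g M ig]; first exact: leqnSn.
    by rewrite inE => /andP[].
  rewrite inE => /andP[vM /clique_tuple [t [st cl]]] rM.
  have tST : t \in ST by rewrite inE.
  have [M' M'cl rM'] := restr_full_clique ig rM (ST_uniq _ tST) cl.
  apply/bigcupP; exists t => //; apply/bigcupP; exists (restr t g); last by rewrite inE.
  apply/bigcupP; exists M' => //; rewrite inE rM' andbT; apply/injectiveP.
  have irg := restr_inj (ST_uniq _ tST) ig; exact: irg.
have leH : #|H| <= #|full_cliques r k P Q| * ('C(L, r * k) * r ^ (r * k)).
  rewrite card_bigcup_readers -sum_nat_const; apply: leq_sum => M.
  by rewrite inE => /andP[vM _]; apply: card_readers.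
have leB : #|B| <= 'C(n, k) * (#|H| * L ^ (r * (n - k))).
  rewrite -(card_ltn_sorted_tuples k n) -/ST -sum_nat_const.
  apply: leq_trans (leq_card_bigcup _ _) _; apply: leq_sum => t tST.
  rewrite -sum_nat_const; apply: leq_trans (leq_card_bigcup _ _) _; apply: leq_sum => h _.
  exact: card_restr_fiber (ST_uniq _ tST) h.
have LrnE : L ^ (r * n) = L ^ (r * k) * L ^ (r * (n - k)).
  by rewrite -expnD -mulnDr subnKC.
have Lpos m : 0 < L ^ m by rewrite expn_gt0.
have leC : 'C(L, r * k) * (r * k)`! <= L ^ (r * k).
  rewrite bin_ffact; elim: (r * k) => // m IH; rewrite ffactnSr expnSr.
  by apply: leq_mul => //; apply: leq_subr.
rewrite -(leq_pmul2r (Lpos (r * n))).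
apply: (@leq_trans ((2 * #|B| * #|V|) * (r * k)`!)); first by rewrite mulnAC leq_mul2r leX orbT.
have := leq_mul (leqnn (2 * #|V| * (r * k)`!)) leB.
have := leq_mul (leqnn (2 * #|V| * (r * k)`! * 'C(n, k) * L ^ (r * (n - k)))) leH.
have := leq_mul (leqnn (2 * #|V| * 'C(n, k) * L ^ (r * (n - k)) * #|full_cliques r k P Q| * r ^ (r * k))) leC.
rewrite LrnE.
move: #|B| #|H| #|V| #|_| (L ^ (r * k)) (L ^ _) ('C(L, _)) ('C(n, k)) (r ^ _) (_`!).
move=> b h v w l1 l2 c1 c2 rr f e1 e2 e3.
lia.
Qed.

Lemma wordM_inj r n : injective (@wordM r n).
Proof.
move=> M1 M2 /eq_in_map eqM; apply/ffunP=> i; apply: eqM; exact: mem_enum.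
Qed.

Lemma full_clique_word r k P Q (M : lmatching r k) :
  M \in full_cliques r k P Q -> PQ_word P Q (wordM M).
Proof.
rewrite inE => /andP[_ /is_cliqueP cl] i j neq.
have := cl i j (in_setT _) (in_setT _) neq; rewrite /forms_PQ pair_wordE //.
by case/orP=> /eqP ->; [left | right].
Qed.

Lemma perm_layer r k p (M : lmatching r k) : valid_matching M -> p < r ->
  perm_eq (layer p (wordM M)) (enum 'I_k).
Proof.
move=> vM ltpr; apply/allP=> e _ /=.
by rewrite count_layer count_wordM // ltpr count_uniq_mem ?enum_uniq // mem_enum.
Qed.

Lemma size_layer r k p (M : lmatching r k) : valid_matching M -> p < r ->
  size (layer p (wordM M)) = k.
Proof. by move=> vM /(perm_layer vM)/perm_size ->; rewrite size_enum_ord. Qed.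

(** The default of [nth] is never reached for a valid matching and [p < r], whose layer has length
    [k]. *)
Definition layer_fun r k p (M : lmatching r k) : {ffun 'I_k -> 'I_k} :=
  [ffun i => nth i (layer p (wordM M)) i].

Lemma layer_fun_eq r k p (M1 M2 : lmatching r k) :
  valid_matching M1 -> valid_matching M2 -> p < r ->
  layer_fun p M1 = layer_fun p M2 -> layer p (wordM M1) = layer p (wordM M2).
Proof.
move=> v1 v2 ltpr eq_f; have s1 := size_layer v1 ltpr; have s2 := size_layer v2 ltpr.
case: k M1 M2 v1 v2 eq_f s1 s2 => [|k] M1 M2 _ _ eq_f s1 s2.
  by rewrite (size0nil s1) (size0nil s2).
apply: (@eq_from_nth _ ord0) => [|i]; rewrite s1 ?s2 // => lti.
have := congr1 (fun f : {ffun 'I_k.+1 -> 'I_k.+1} => f (Ordinal lti)) eq_f.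
rewrite !ffunE /= => e; rewrite (set_nth_default (Ordinal lti)) ?s1 // e.
by rewrite (set_nth_default ord0) ?s2.
Qed.

(** Reduction modulo [r] only serves the type: the occurrence numbers of a valid matching are below
    [r]. *)
Definition profile_fun r k (r0 : 0 < r) (M : lmatching r k) : {ffun 'I_(r * k) -> 'I_r} :=
  [ffun x : 'I_(r * k) => Ordinal (ltn_pmod (nth 0 (profile (wordM M)) x) r0)].

Lemma profile_fun_eq r k (r0 : 0 < r) (M1 M2 : lmatching r k) :
  valid_matching M1 -> valid_matching M2 ->
  profile_fun r0 M1 = profile_fun r0 M2 -> profile (wordM M1) = profile (wordM M2).
Proof.
have size_prof (M : lmatching r k) : size (profile (wordM M)) = r * k.
  by rewrite size_map -(size_map fst) annot_fst size_wordM.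
have prof_lt (M : lmatching r k) i : valid_matching M -> i < r * k ->
    nth 0 (profile (wordM M)) i < r.
  move=> vM lti; have : nth 0 (profile (wordM M)) i \in profile (wordM M).
    by rewrite mem_nth ?size_prof.
  by case/mapP=> z /annot_lt; rewrite count_wordM // => /andP[_ lt] ->.
move=> v1 v2 eq_f; apply: (@eq_from_nth _ 0) => [|i]; rewrite size_prof ?size_prof // => lti.
have := congr1 (fun f : {ffun 'I_(r * k) -> 'I_r} => val (f (Ordinal lti))) eq_f.
by rewrite !ffunE /= !modn_small ?prof_lt.
Qed.

(** Two layers give [k ^ (2k)], written in the form [(B * k ^ d.+1) ^ k] with [B = 1] and
    [d = 1]. *)
Lemma card_harmonious_cliques r k P Q : is_pattern r P -> harmonious P Q ->
  #|full_cliques r k P Q| <= (1 * k ^ 2) ^ k.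
Proof.
move=> pP /harmonious_split[p [U [b [Y [Z [eP eQ bU]]]]]].
have ltpr : p < r.
  have := balanced_size (is_pattern_balanced pP).
  by rewrite eP size_cat /= (balanced_size bU); lia.
have r0 : 0 < r by apply: leq_ltn_trans ltpr.
pose F (M : lmatching r k) := (layer_fun 0 M, layer_fun p M).
have F_inj : {in full_cliques r k P Q &, injective F}.
  move=> M1 M2 c1 c2 [e0 ep]; apply: wordM_inj.
  have [v1 v2] : valid_matching M1 /\ valid_matching M2.
    by move: c1 c2; rewrite !inE => /andP[-> _] /andP[-> _].
  apply: (PQ_word_layers_inj eP eQ bU (full_clique_word c1) (full_clique_word c2)).
  - by rewrite !size_wordM.
  - exact: layer_fun_eq e0.
  - exact: layer_fun_eq ep.
have := @leq_card_in _ _ F _ F_inj.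
by rewrite card_prod !card_ffun !card_ord mul1n -mulnn expnMn.
Qed.

(** There are [r ^ (rk)] candidates for the profile and [k ^ k] for the layer, so [B = r ^ r] and
    [d = 0]. *)
Lemma card_mismatch_cliques r k P Q : is_pattern r P -> is_pattern r Q ->
  mismatch P Q -> #|full_cliques r k P Q| <= (r ^ r * k ^ 1) ^ k.
Proof.
move=> pP pQ mis; have [p [U V P' Q' u c X Y eP eQ bU bV eP' eQ' unb]] := mismatch_splits_apart pP pQ mis.
have ltpr : p < r.
  have := balanced_size (is_pattern_balanced pP).
  rewrite eP size_cat -(size_map (fun b => b != head false P') P') -/(norm P') eP'.
  by rewrite size_cat /= (balanced_size bU); lia.
have r0 : 0 < r by apply: leq_ltn_trans ltpr.
pose F (M : lmatching r k) := (profile_fun r0 M, layer_fun p M).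
have F_inj : {in full_cliques r k P Q &, injective F}.
  move=> M1 M2 c1 c2 [e0 ep]; apply: wordM_inj.
  have [v1 v2] : valid_matching M1 /\ valid_matching M2.
    by move: c1 c2; rewrite !inE => /andP[-> _] /andP[-> _].
  apply: (PQ_word_profile_inj eP eQ bU bV eP' eQ' unb (full_clique_word c1) (full_clique_word c2)).
  - by rewrite !size_wordM.
  - exact: profile_fun_eq e0.
  - exact: layer_fun_eq ep.
have := @leq_card_in _ _ F _ F_inj.
by rewrite card_prod !card_ffun !card_ord expn1 expnMn -expnM.
Qed.

(** In [4 ^ r.+1], the part [4 ^ r] comes from [(rk) ^ (rk) <= 4 ^ (rk) (rk)!] and one more [4] from
    [k ^ k <= 4 ^ k k!]. The lower bound on [k] makes each of [k] factors at most [1/2]. *)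
Lemma large_clique_tail r n k d B P Q : 0 < r -> 0 < n -> 0 < k -> 0 < B -> d <= r ->
  #|full_cliques r k P Q| <= (B * k ^ d.+1) ^ k ->
  2 * (4 ^ r.+1 * B) * n <= k ^ (r - d) ->
  #|[set M : lmatching r n | valid_matching M && (k <= zPQ P Q M)]| * 2 ^ k
  <= 2 * #|[set M : lmatching r n | valid_matching M]|.
Proof.
move=> r0 n0 k0 B0 ledr leW leK.
have := large_clique_count r n k P Q.
set x := #|_|; set v := #|[set M | valid_matching M]|; set w := #|_| in leW *.
set R := r ^ (r * k) => main.
pose A := 4 ^ r.+1 * B * k ^ d * n.
have A0 : 0 < A by rewrite !muln_gt0 !expn_gt0 k0 B0 n0.
have R0 : 0 < R by rewrite expn_gt0 r0.
have leA : (2 * A) ^ k <= k ^ (r * k).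
  rewrite expnM; apply: leq_expnl; rewrite -(subnK ledr) expnD.
  by apply: leq_trans (leq_mul leK (leqnn (k ^ d))); rewrite /A; lia.
have fact_rk : R * k ^ (r * k) <= 4 ^ (r * k) * (r * k)`!.
  by rewrite -expnMn; apply: expn_self_le_fact.
have leC : 'C(n, k) * k`! <= n ^ k.
  rewrite bin_ffact; elim: (k) => // m IH; rewrite ffactnSr expnSr.
  by apply: leq_mul => //; apply: leq_subr.
have leCw : 'C(n, k) * w <= 4 ^ k * (B * k ^ d * n) ^ k.
  apply: leq_trans (leq_mul (leqnn _) leW) _.
  rewrite expnS (mulnCA B) (expnMn k) mulnA.
  apply: (@leq_trans ('C(n, k) * (4 ^ k * k`!) * (B * k ^ d) ^ k)).
    by rewrite leq_mul2r leq_mul2l expn_self_le_fact !orbT.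
  rewrite (expnMn _ n); have := leq_mul leC (leqnn (4 ^ k * (B * k ^ d) ^ k)).
  set e1 := 4 ^ k; set e2 := (B * _) ^ k; lia.
have key : x * (R * (2 * A) ^ k) <= 2 * v * (R * A ^ k).
  apply: leq_trans (leq_mul (leqnn x) (leq_mul (leqnn R) leA)) _.
  apply: leq_trans (leq_mul (leqnn x) fact_rk) _.
  rewrite mulnCA; apply: leq_trans (leq_mul (leqnn (4 ^ (r * k))) main) _.
  have -> : A ^ k = 4 ^ (r * k) * (4 ^ k * (B * k ^ d * n) ^ k).
    by rewrite expnM -!expnMn; congr (_ ^ _); rewrite /A expnS; lia.
  have := leq_mul (leqnn (4 ^ (r * k) * 2 * R * v)) leCw.
  set e1 := 4 ^ (r * k); set e2 := 4 ^ k * _; lia.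
have RA0 : 0 < R * A ^ k by rewrite muln_gt0 R0 expn_gt0 A0.
by rewrite -(leq_pmul2r RA0); move: key; rewrite expnMn; lia.
Qed.

(** A.a.s. without real numbers: for every positive [K] the failure probability is eventually at
    most [1 / K]. *)
Definition whp r (E : forall n, lmatching r n -> bool) := forall K, exists N, forall n,
  N <= n -> K * #|[set M : lmatching r n | valid_matching M && ~~ E n M]|
            <= #|[set M : lmatching r n | valid_matching M]|.

Lemma whp_imp r (E F : forall n, lmatching r n -> bool) : 
  (exists N, forall n (M : lmatching r n), N <= n -> valid_matching M -> E n M -> F n M) ->
  whp E -> whp F.
Proof.
move=> [N1 EF] hE K; have [N hN] := hE K; exists (maxn N1 N) => n.
rewrite geq_max => /andP[le1 le2]; apply: leq_trans (hN n le2); rewrite leq_mul2l.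
apply/orP; right; apply: subset_leq_card; apply/subsetP=> M; rewrite !inE.
by case/andP=> vM nF; rewrite vM /=; apply: contra nF; apply: EF.
Qed.

Lemma whp_and r (E F : forall n, lmatching r n -> bool) : whp E -> whp F ->
  whp (fun n M => E n M && F n M).
Proof.
move=> hE hF K; have [N1 h1] := hE (2 * K); have [N2 h2] := hF (2 * K).
exists (maxn N1 N2) => n; rewrite geq_max => /andP[/h1 le1 /h2 le2].
set X := [set M | _ && ~~ (_ && _)].
have : #|X| <= #|[set M : lmatching r n | valid_matching M && ~~ E n M]| +
               #|[set M : lmatching r n | valid_matching M && ~~ F n M]|.
  apply: leq_trans (leq_card_setU _ _); apply: subset_leq_card; apply/subsetP=> M.
  by rewrite !inE negb_and => /andP[-> /=].
move: le1 le2; move: #|_| #|_| #|_| #|_| => a b c d; nia.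
Qed.

Lemma whp_zPQ_upper r d B P Q : 0 < B -> d < r ->
  (forall k, #|full_cliques r k P Q| <= (B * k ^ d.+1) ^ k) ->
  whp (fun n (M : lmatching r n) => zPQ P Q M ^ (r - d) < 2 * (4 ^ r.+1 * B) * n).
Proof.
move=> B0 ltdr hW K; set D := 2 * (4 ^ r.+1 * B).
have D0 : 0 < D by rewrite !muln_gt0 expn_gt0 B0.
have w0 : 0 < r - d by rewrite subn_gt0.
exists ((2 * K) ^ (r - d)).+1 => n leNn.
have n0 : 0 < n by apply: leq_trans leNn.
have exk : exists k, D * n <= k ^ (r - d).
  by exists (D * n); rewrite -{1}(expn1 (D * n)) leq_pexp2l // muln_gt0 D0.
(* For the least [k] with [D * n <= k ^ (r - d)], failure of the bound means [k <= zPQ P Q M];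
   moreover [k] grows with [n]. *)
case: (ex_minnP exk) => k lek mink.
have k0 : 0 < k.
  have : 0 < D * n by rewrite muln_gt0 D0.
  by case: k lek {mink} => //; rewrite exp0n //; case: (D * n).
have leKk : 2 * K <= k.
  rewrite leqNgt; apply/negP=> ltk; have : k ^ (r - d) < (2 * K) ^ (r - d) by rewrite ltn_exp2r.
  have : n <= D * n by apply: leq_pmull.
  lia.
have r0 : 0 < r by apply: leq_ltn_trans ltdr.
have := large_clique_tail r0 n0 k0 B0 (ltnW ltdr) (hW k) lek.
set x := #|_|; set v := #|_|.
have lex : #|[set M : lmatching r n | valid_matching M && ~~ (zPQ P Q M ^ (r - d) < D * n)]| <= x.
  apply: subset_leq_card; apply/subsetP=> M; rewrite !inE -leqNgt => /andP[-> /mink] //.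
have leKe : 2 * K <= 2 ^ k by apply: leq_trans leKk (ltnW (ltn_expl k (isT : 1 < 2))).
have lexe := leq_mul leKe lex; move: lexe.
by move: (2 ^ k) #|_| => e y h1 h2; rewrite -(leq_pmul2l (isT : 0 < 2)); lia.
Qed.

(** * Lower bounds *)

Section Cells.
Variables (r n N Lc : nat).
Hypothesis Lc0 : 0 < Lc.
Implicit Types (g : {ffun 'I_n * 'I_r -> 'I_(N * Lc)}).

Lemma cell_lt (x : 'I_(N * Lc)) : x %/ Lc < N.
Proof. by rewrite ltn_divLR. Qed.

Definition cell_of (x : 'I_(N * Lc)) : 'I_N := Ordinal (cell_lt x).

Definition edge_cells g e : {ffun 'I_r -> 'I_N} := [ffun a => cell_of (g (e, a))].

(** A value is its cell together with its offset in the cell, and the edges choose independently. *)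
Lemma card_avoid (F : {set {ffun 'I_r -> 'I_N}}) :
  #|[set g | [forall e, edge_cells g e \notin F]]| <= ((N ^ r - #|F|) * Lc ^ r) ^ n.
Proof.
pose inner (x : 'I_(N * Lc)) : 'I_Lc := Ordinal (ltn_pmod x Lc0).
pose G g : {ffun 'I_n -> {ffun 'I_r -> 'I_N} * {ffun 'I_r -> 'I_Lc}} :=
  [ffun e => (edge_cells g e, [ffun a => inner (g (e, a))])].
have G_inj : injective G.
  move=> g1 g2 eqG; apply/ffunP=> -[e a]; apply: val_inj => /=.
  have := congr1 (fun f : {ffun 'I_n -> _ * _} => f e) eqG; rewrite !ffunE => -[e1 e2].
  have := congr1 (fun f : {ffun 'I_r -> 'I_N} => val (f a)) e1.
  have := congr1 (fun f : {ffun 'I_r -> 'I_Lc} => val (f a)) e2.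
  rewrite !ffunE /= => em ed.
  by rewrite (divn_eq (g1 (e, a)) Lc) em ed -divn_eq.
have -> : (N ^ r - #|F|) * Lc ^ r = #|setX (~: F) [set: {ffun 'I_r -> 'I_Lc}]|.
  by rewrite cardsX cardsT card_ffun !card_ord (cardsCs (~: F)) setCK card_ffun !card_ord.
rewrite -[n in _ ^ n]card_ord -card_ffun_on -(card_imset _ G_inj).
apply: subset_leq_card; apply/subsetP=> _ /imsetP[g + ->].
rewrite inE => /forallP av; apply/ffun_onP=> e; rewrite ffunE.
by apply/setXP; rewrite !inE av.
Qed.

Definition vals (phi : {ffun 'I_r -> 'I_N}) : seq nat := [seq val (phi a) | a <- enum 'I_r].

Lemma cells_lw g (M : lmatching r n) e f : injective g -> reads g M -> e != f ->
  uniq (vals (edge_cells g e) ++ vals (edge_cells g f)) ->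
  lw (wordM M) e f = map snd (lab (vals (edge_cells g e)) (vals (edge_cells g f))).
Proof.
move=> ig rM neq; rewrite (reads_lw ig rM neq).
have valsE e' : vals (edge_cells g e') = map (divn^~ Lc) (row g e').
  by rewrite -map_comp; apply: eq_map => a; rewrite /= ffunE.
rewrite !valsE -map_cat => uniq_cells; rewrite lab_map // => x y.
exact: leq_div2r.
Qed.

End Cells.

(** Union bound over [S]: [X] has probability at most [2 |S| (1 - f / N^r)^n]. The cell size [Lc] is
    free and is taken large enough for injections to form half of all maps. *)
Lemma avoid_count r n N (J : finType) (S : {set J})
    (F : J -> {set {ffun 'I_r -> 'I_N}}) (X : {set lmatching r n}) f : 0 < N ->
  (forall M, M \in X -> valid_matching M) -> (forall j, j \in S -> f <= #|F j|) ->
  (forall Lc (Lc0 : 0 < Lc) (g : {ffun 'I_n * 'I_r -> 'I_(N * Lc)}) M,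
     M \in X -> injective g -> reads g M ->
     exists2 j, j \in S & forall e, edge_cells Lc0 g e \notin F j) ->
  #|X| * (N ^ r) ^ n <= 2 * #|S| * (N ^ r - f) ^ n *
    #|[set M : lmatching r n | valid_matching M]|.
Proof.
move=> N0 vX leF hX; pose Lc := (2 * (r * n) ^ 2).+1; have Lc0 : 0 < Lc by [].
pose B := \bigcup_(j in S) [set g : {ffun 'I_n * 'I_r -> 'I_(N * Lc)} |
  [forall e, edge_cells Lc0 g e \notin F j]].
have leB : #|B| <= #|S| * ((N ^ r - f) ^ n * (Lc ^ r) ^ n).
  apply: leq_trans (leq_card_bigcup _ _) _; rewrite -sum_nat_const; apply: leq_sum => j jS.
  apply: leq_trans (card_avoid _ _ _) _; rewrite expnMn leq_mul2r; apply/orP; right.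
  by apply: leq_expnl; apply: leq_sub2l; apply: leF.
have := @card_bad_matchings r n (N * Lc) X B.
set v := #|[set M | _]| => /(_ _ vX) leX.
have {leX} : #|X| * (N * Lc) ^ (r * n) <= 2 * #|B| * v.
  apply: leX => [|g M ig MX rM].
    by apply: leq_trans (leqnSn _) _; rewrite -/Lc; apply: leq_pmull.
  have [j jS av] := hX _ Lc0 g M MX ig rM.
  by apply/bigcupP; exists j; rewrite // inE; apply/forallP.
have Lp : 0 < (Lc ^ r) ^ n by rewrite !expn_gt0.
rewrite expnM expnMn expnMn => leX; rewrite -(leq_pmul2r Lp).
have := leq_mul (leqnn (2 * v)) leB; lia.
Qed.

Lemma zPQ_ge r n P Q (M : lmatching r n) (S : {set 'I_n}) :
  (forall e f, e \in S -> f \in S -> e != f -> forms_PQ P Q M e f) -> #|S| <= zPQ P Q M.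
Proof.
move=> cl; have clS : is_clique P Q M S by apply/is_cliqueP.
exact: (@leq_bigmax_cond _ (is_clique P Q M) (fun S : {set 'I_n} => #|S|)).
Qed.

(** The values are cut into [r * z] cells, matching the [r * z] values of a reader of [M0]. Edges
    that occupy the cells of the edges of [M0] form a copy of [M0], so failure means that the cells
    of some edge [j] of [M0] are avoided. *)
Lemma whp_contains_clique r z P Q (M0 : lmatching r z) : 0 < r -> 0 < z ->
  valid_matching M0 -> is_clique P Q M0 [set: 'I_z] ->
  whp (fun n (M : lmatching r n) => z <= zPQ P Q M).
Proof.
move=> r0 z0 v0 cl0; have N0 : 0 < r * z by rewrite muln_gt0 r0.
have [g0] := readers_ex (leqnn (r * z)) v0; rewrite inE => /andP[/injectiveP ig0 rM0].
pose phi (j : 'I_z) : {ffun 'I_r -> 'I_(r * z)} := [ffun a => g0 (j, a)].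
have phi_inj : injective phi.
  move=> i j /ffunP/(_ (Ordinal r0)); rewrite !ffunE => /ig0 [] //.
have vals_phi j : vals (phi j) = row g0 j by apply: eq_map => a; rewrite ffunE.
have uniq_phi i j : i != j -> uniq (vals (phi i) ++ vals (phi j)).
  move=> neq; rewrite !vals_phi cat_uniq.
  have u k : uniq (row g0 k).
    by rewrite map_inj_uniq ?enum_uniq // => a b /val_inj /ig0 [].
  rewrite !u andbT; apply/hasPn => _ /mapP[a _ ->]; apply/mapP => -[b _ /val_inj /ig0 [] /eqP].
  by rewrite eq_sym (negbTE neq).
set T := (r * z) ^ r; have T0 : 0 < T by rewrite expn_gt0 N0.
(* The failure probability will be at most [2 z T / (T + n)]. *)
move=> K; exists (2 * z * T * K) => n leNn.
set X := [set M | _ && _]; set v := #|[set M | valid_matching M]|.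
have hX : #|X| * T ^ n <= 2 * #|[set: 'I_z]| * (T - 1) ^ n * v.
  apply: (@avoid_count r n (r * z) _ [set: 'I_z] (fun j => [set phi j])) => //.
  - by move=> M; rewrite inE => /andP[].
  - by move=> j _; rewrite cards1.
  move=> Lc Lc0 g M; rewrite inE -ltnNge => /andP[vM ltz] ig rM.
  have [/exists_inP[j _ /forallP av]|] := boolP [exists j in [set: 'I_z],
     [forall e, edge_cells Lc0 g e \notin [set phi j]]]; first by exists j.
  rewrite negb_exists_in => /forall_inP ex_e.
  have ex_e' j : exists e, edge_cells Lc0 g e == phi j.
    have := ex_e j (in_setT _); rewrite negb_forall => /existsP[e].
    by rewrite negbK inE; exists e.
  pose ef j := xchoose (ex_e' j).
  have efP j : edge_cells Lc0 g (ef j) = phi j by apply/eqP/(xchooseP (ex_e' j)).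
  have ef_inj : injective ef by move=> i j eq_e; apply: phi_inj; rewrite -!efP eq_e.
  have : #|ef @: [set: 'I_z]| <= zPQ P Q M.
    apply: zPQ_ge => _ _ /imsetP[i _ ->] /imsetP[j _ ->] neq.
    have neq_ij : i != j by apply: contra neq => /eqP ->.
    have := is_cliqueP _ _ _ _ cl0 i j (in_setT _) (in_setT _) neq_ij.
    rewrite /forms_PQ (@lw_pair_word _ _ M _ M0 (ef i) (ef j) i j neq neq_ij) //.
    rewrite (cells_lw ig rM neq) !efP ?uniq_phi // !vals_phi.
    by rewrite (reads_lw ig0 rM0 neq_ij).
  by rewrite card_imset // cardsT card_ord leqNgt ltz.
have decay := expn_sub_hyp_decay n T0; rewrite cardsT card_ord in hX.
have Tn0 : 0 < T ^ n by rewrite expn_gt0 T0.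
have : #|X| * (T + n) <= 2 * z * T * v.
  rewrite -(leq_pmul2r Tn0).
  have := leq_mul hX (leqnn (T + n)); have := leq_mul (leqnn (2 * z * v)) decay.
  move: (T ^ n) ((T - 1) ^ n) => e1 e2; lia.
move=> le1; have zT0 : 0 < 2 * z * T by rewrite !muln_gt0 z0.
rewrite -(leq_pmul2l zT0) mulnA.
apply: leq_trans le1; rewrite mulnC leq_mul2l; apply/orP; right.
by apply: leq_trans leNn (leq_addl _ _).
Qed.

(** A segment consists of the direction of a block in [P], its direction in [Q] and the common
    half-length. *)
Definition seg := (bool * bool * nat)%type.

Definition segsP (s : seq seg) :=
  flatten [seq nseq z.2 z.1.1 ++ nseq z.2 (~~ z.1.1) | z <- s].
Definition segsQ (s : seq seg) :=
  flatten [seq nseq z.2 z.1.2 ++ nseq z.2 (~~ z.1.2) | z <- s].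

(* An edge of type (x, y) uses the x-th of the m blocks of a segment in which
   P and Q have the same direction and the y-th one elsewhere, counted from the
   right if P reverses the segment. *)
Definition blk m (z : seg) x y :=
  let u := if z.1.1 == z.1.2 then x else y in if z.1.1 then m.-1 - u else u.

(** A segment of half-length [t] takes [t * m] consecutive cells from offset [o] on, in [m] blocks
    of [t] cells, so that one block provides [t] vertices of an edge. *)
Fixpoint cells m o (s : seq seg) x y : seq nat :=
  if s is z :: s' then iota (o + z.2 * blk m z x y) z.2 ++ cells m (o + z.2 * m) s' x y
  else [::].

(** The expected result of sorting the labelled cells of two types, segment by segment. *)
Fixpoint merged m o (s : seq seg) x y x' y' : seq (nat * bool) :=
  if s is z :: s' then
    let A := [seq (c, false) | c <- iota (o + z.2 * blk m z x y) z.2] in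
    let B := [seq (c, true) | c <- iota (o + z.2 * blk m z x' y') z.2] in
    (if blk m z x y < blk m z x' y' then A ++ B else B ++ A)
      ++ merged m (o + z.2 * m) s' x y x' y'
  else [::].

Section Blocks.
Variables (m : nat).
Implicit Types (s : seq seg) (z : seg).

Lemma blk_lt z x y : x < m -> y < m -> blk m z x y < m.
Proof. by rewrite /blk; case: (z.1.1 == z.1.2) => /=; case: (z.1.1) => /=; lia. Qed.

Lemma size_cells o s x y : size (cells m o s x y) = sumn (map snd s).
Proof. by elim: s o => //= z s IH o; rewrite size_cat size_iota IH. Qed.

Lemma merged_perm o s x y x' y' :
  perm_eq (merged m o s x y x' y') (labelled (cells m o s x y) (cells m o s x' y')).
Proof.
elim: s o => // z s IH o; apply/seq.permP => p; have /seq.permP/(_ p) := IH (o + z.2 * m).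
rewrite /labelled /= !map_cat !count_cat => ->.
by case: ifP => _; rewrite !count_cat; lia.
Qed.

Lemma merged_range o s x y x' y' : x < m -> y < m -> x' < m -> y' < m ->
  all (fun c => o <= c.1 < o + m * sumn (map snd s)) (merged m o s x y x' y').
Proof.
move=> hx hy hx' hy'; elim: s o => //= z s IH o.
have b1 := blk_lt z hx hy; have b2 := blk_lt z hx' hy'.
have rng (b : bool) d : d < m -> all (fun c => o <= c.1 < o + m * (z.2 + sumn (map snd s)))
    [seq (c, b) | c <- iota (o + z.2 * d) z.2].
  move=> hd; rewrite all_map; apply/allP=> c; rewrite mem_iota /=.
  have := leq_mul (leqnn z.2) hd; rewrite mulnDr; nia.
rewrite all_cat; apply/andP; split.
  by case: ifP => _; rewrite all_cat !rng.
apply: sub_all (IH (o + z.2 * m)) => c /=; rewrite mulnDr; nia.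
Qed.

(** Distinct [x] and distinct [y] put the two types into different blocks of every segment, and
    later segments lie entirely to the right. *)
Lemma merged_sorted o s x y x' y' : x < m -> y < m -> x' < m -> y' < m ->
  x != x' -> y != y' -> sorted ltn (map fst (merged m o s x y x' y')).
Proof.
move=> hx hy hx' hy' nx ny; rewrite sorted_pairwise; last exact: ltn_trans.
elim: s o => //= z s IH o.
have b1 := blk_lt z hx hy; have b2 := blk_lt z hx' hy'.
have nb : blk m z x y != blk m z x' y' by rewrite /blk; case: (z.1.1 == z.1.2) => /=; case: (z.1.1) => /=; lia.
rewrite map_cat pairwise_cat IH andbT.
have mem_rng (b : bool) d c : d < m -> c \in [seq (c, b) | c <- iota (o + z.2 * d) z.2] ->
    o + z.2 * d <= c.1 < o + z.2 * d.+1.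
  by move=> hd /mapP[c' + ->]; rewrite mem_iota /=; lia.
set A := [seq (c, false) | c <- _]; set B := [seq (c, true) | c <- _].
have pw (b : bool) d : pairwise ltn (map fst [seq (c, b) | c <- iota d z.2]).
  rewrite -map_comp (eq_map (_ : _ =1 id)) // map_id -sorted_pairwise; last exact: ltn_trans.
  exact: iota_ltn_sorted.
apply/andP; split.
  apply/allrelP => _ _ /mapP[c cAB ->] /mapP[d dM ->].
  have /allP/(_ _ dM)/andP[le_d _] := merged_range (o + z.2 * m) s hx hy hx' hy'.
  apply: leq_trans le_d; have : (c \in A) || (c \in B).
    by move: cAB; case: ifP => _; rewrite mem_cat // orbC.
  case/orP=> /mem_rng.
    by move=> /(_ b1) /andP[_ lt]; apply: leq_trans lt _; rewrite leq_add2l leq_mul2l b1 orbT.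
  by move=> /(_ b2) /andP[_ lt]; apply: leq_trans lt _; rewrite leq_add2l leq_mul2l b2 orbT.
have sep (b b' : bool) d d' : d < m -> d' < m -> d < d' ->
    allrel ltn (map fst [seq (c, b) | c <- iota (o + z.2 * d) z.2])
               (map fst [seq (c, b') | c <- iota (o + z.2 * d') z.2]).
  move=> hd hd' ltd; apply/allrelP=> _ _ /mapP[c cin ->] /mapP[c' cin' ->].
  have /andP[_ lt1] := mem_rng _ _ _ hd cin; have /andP[le2 _] := mem_rng _ _ _ hd' cin'.
  apply: leq_trans lt1 (leq_trans _ le2); rewrite leq_add2l leq_mul2l ltd orbT //.
case: ifP => ltb; rewrite map_cat pairwise_cat !pw !andbT; apply: sep => //.
by rewrite ltn_neqAle eq_sym nb leqNgt ltb.
Qed.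

(** A segment compares the [x]'s where [P] and [Q] agree and the [y]'s elsewhere, reversed if [P]
    reverses it. If both comparisons go the same way, the directions are those of [P]; otherwise the
    opposite segments are flipped, which gives [Q]. *)
Lemma merged_word o s x y x' y' : x < m -> y < m -> x' < m -> y' < m ->
  x != x' -> y != y' -> exists h,
  map snd (merged m o s x y x' y') = map (addb h) (segsP s) \/
  map snd (merged m o s x y x' y') = map (addb h) (segsQ s).
Proof.
move=> hx hy hx' hy' nx ny; exists (x' < x).
have wordE o' : map snd (merged m o' s x y x' y') =
    flatten [seq nseq z.2 (blk m z x' y' < blk m z x y) ++
                 nseq z.2 (~~ (blk m z x' y' < blk m z x y)) | z <- s].
  elim: s o' => //= z s IH o'; rewrite map_cat IH; congr cat.
  have nb : blk m z x y != blk m z x' y' by rewrite /blk; case: (z.1.1 == z.1.2) => /=; case: (z.1.1) => /=; lia.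
  have consts b d : map snd [seq (c, b) | c <- iota d z.2] = nseq z.2 b :> seq bool.
    by rewrite -map_comp; elim: (z.2) d => //= t IHt d; rewrite IHt.
  have -> : (blk m z x y < blk m z x' y') = ~~ (blk m z x' y' < blk m z x y).
    by rewrite ltn_neqAle nb leqNgt.
  by case: (_ < _) => /=; rewrite map_cat !consts.
rewrite wordE /segsP /segsQ !map_flatten -!map_comp.
have [same|opp] := eqVneq (x' < x) (y' < y); [left | right]; congr flatten;
  apply: eq_map => -[[b1 b2] t]; rewrite /= map_cat !map_nseq /blk /=.
  have -> : (if b1 then m.-1 - (if b1 == b2 then x' else y') else if b1 == b2 then x' else y')
     < (if b1 then m.-1 - (if b1 == b2 then x else y) else if b1 == b2 then x else y)
     = (x' < x) (+) b1 by move: same; case: b1; case: b2 => /=; lia.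
  by rewrite addbN.
have -> : (if b1 then m.-1 - (if b1 == b2 then x' else y') else if b1 == b2 then x' else y')
     < (if b1 then m.-1 - (if b1 == b2 then x else y) else if b1 == b2 then x else y)
     = (x' < x) (+) b2 by move: opp; case: b1; case: b2 => /=; lia.
by rewrite addbN.
Qed.

Lemma cells_blk_inj o s x y x' y' : cells m o s x y = cells m o s x' y' ->
  all (fun z => 0 < z.2) s -> forall z, z \in s -> blk m z x y = blk m z x' y'.
Proof.
elim: s o => //= z0 s IH o /eqP; rewrite eqseq_cat ?size_iota // => /andP[/eqP e0 /eqP e1].
case/andP=> pos0 pos z; rewrite inE => /predU1P[->|]; last exact: IH e1 pos z.
move: e0; rewrite -(prednK pos0) /= => -[/addnI e _]; move: e.
by rewrite prednK // => /eqP; rewrite eqn_mul2l => /orP[/eqP|/eqP //]; lia.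
Qed.

Lemma blk_inj z x y x' y' : x < m -> y < m -> x' < m -> y' < m ->
  blk m z x y = blk m z x' y' -> if z.1.1 == z.1.2 then x = x' else y = y'.
Proof. by rewrite /blk; case: (z.1.1 == z.1.2) => /=; case: (z.1.1) => /=; lia. Qed.

End Blocks.

(** All types for two harmonious patterns; only the diagonal for a single pattern, where [x] alone
    matters. *)
Definition types (full : bool) m : {set 'I_m * 'I_m} := [set k | full || (k.1 == k.2)].

(** At least [(3m/4)^2] types remain in the full case and [m - 2h >= m/2] on the diagonal. *)
Lemma card_types_avoid (full : bool) m (A B : {set 'I_m}) h : 4 * h <= m -> #|A| <= h -> #|B| <= h ->
  m ^ full.+1 <= 4 * #|[set k in types full m | (k.1 \notin A) && (k.2 \notin B)]|.
Proof.
move=> le_h leA leB; have cA := cardsC A; have cB := cardsC B.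
rewrite card_ord in cA; rewrite card_ord in cB; case: full.
  have -> : [set k in types true m | (k.1 \notin A) && (k.2 \notin B)] = setX (~: A) (~: B).
    by apply/setP=> -[x y]; rewrite !inE.
  rewrite cardsX -mulnn; move: #|~: A| #|~: B| cA cB => a b cA cB.
  have la : 3 * m <= 4 * a by lia.
  have lb : 3 * m <= 4 * b by lia.
  have := leq_mul la lb; nia.
have inj_diag : injective (fun x : 'I_m => (x, x)) by move=> x y [].
have := card_imset (~: (A :|: B)) inj_diag.
have := cardsC (A :|: B); rewrite card_ord => cAB.
have [le_cup _] := leq_card_setU A B.
move=> ci; rewrite expn1; apply: (@leq_trans (4 * #|~: (A :|: B)|)).
  by lia.
rewrite -ci leq_mul2l; apply: subset_leq_card; apply/subsetP=> _ /imsetP[x + ->].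
by rewrite !inE negb_or eqxx.
Qed.

(** * Large cliques for patterns with a common composition *)

Section CollectableLower.
Variables (r : nat) (P Q : seq bool) (s : seq seg) (full : bool).
Hypotheses (eP : P = segsP s) (eQ : Q = segsQ s).
Hypotheses (hP : head true P = false) (hQ : head true Q = false).
Hypotheses (pos_s : all (fun z => 0 < z.2) s) (sum_s : sumn (map snd s) = r).
Hypotheses (same_s : has (fun z => z.1.1 == z.1.2) s)
           (diff_s : full -> has (fun z => z.1.1 != z.1.2) s).
Hypothesis lt_full : full < r.

Let type_cells m (k : 'I_m * 'I_m) := cells m 0 s k.1 k.2.

Lemma type_cells_lt m (k : 'I_m * 'I_m) c : c \in type_cells k -> c < r * m.
Proof.
move=> ck; have := merged_range 0 s (ltn_ord k.1) (ltn_ord k.2) (ltn_ord k.1) (ltn_ord k.2).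
have mc : (c, false) \in merged m 0 s k.1 k.2 k.1 k.2.
  by rewrite (perm_mem (merged_perm _ _ _ _ _ _ _)) mem_cat map_f.
by move/allP/(_ _ mc); rewrite sum_s mulnC.
Qed.

Lemma type_cell_lt m (k : 'I_m * 'I_m) (a : 'I_r) : nth 0 (type_cells k) a < r * m.
Proof. by apply: (@type_cells_lt _ k); rewrite mem_nth // size_cells sum_s. Qed.

Let phi m (k : 'I_m * 'I_m) : {ffun 'I_r -> 'I_(r * m)} :=
  [ffun a => Ordinal (type_cell_lt k a)].

Lemma vals_phi m (k : 'I_m * 'I_m) : vals (phi k) = type_cells k.
Proof.
rewrite /vals (eq_map (_ : _ =1 (nth 0 (type_cells k)) \o val)); last first.
  by move=> a; rewrite ffunE.
by rewrite map_comp val_enum_ord map_nth_iota0 ?take_oversize // size_cells sum_s.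
Qed.

(** A segment where [P] and [Q] agree reveals [x]; then [y] is revealed by an opposite segment, or
    equals [x] on the diagonal. *)
Lemma phi_inj m : {in types full m &, injective (@phi m)}.
Proof.
move=> [x y] [x' y']; rewrite !inE /= => dxy dxy' /(congr1 (@vals _ _)).
rewrite !vals_phi => /cells_blk_inj/(_ pos_s) eq_blk.
have [z zs ez] := hasP same_s.
have := blk_inj (ltn_ord x) (ltn_ord y) (ltn_ord x') (ltn_ord y') (eq_blk z zs).
rewrite ez => /val_inj ex; case: full diff_s dxy dxy' => [/(_ isT)/hasP[z' zs' nz'] _ _|_].
  have := blk_inj (ltn_ord x) (ltn_ord y) (ltn_ord x') (ltn_ord y') (eq_blk z' zs').
  by rewrite (negbTE nz') ex => /val_inj ->.
by move=> /eqP <- /eqP <-; rewrite ex.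
Qed.

Lemma phi_forms_PQ m n Lc (Lc0 : 0 < Lc) (g : {ffun 'I_n * 'I_r -> 'I_(r * m * Lc)})
    (M : lmatching r n) e f (k l : 'I_m * 'I_m) : injective g -> reads g M -> e != f ->
  edge_cells Lc0 g e = phi k -> edge_cells Lc0 g f = phi l ->
  k.1 != l.1 -> k.2 != l.2 -> forms_PQ P Q M e f.
Proof.
move=> ig rM neq ek fl n1 n2.
have perm_m := merged_perm m 0 s k.1 k.2 l.1 l.2.
have sorted_m := merged_sorted 0 s (ltn_ord k.1) (ltn_ord k.2) (ltn_ord l.1) (ltn_ord l.2) n1 n2.
have uniq_kl : uniq (type_cells k ++ type_cells l).
  have := perm_uniq (perm_map fst perm_m).
  rewrite (sorted_uniq ltn_trans ltnn sorted_m) /labelled map_cat -!map_comp.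
  by rewrite !(eq_map (_ : _ =1 id)) // !map_id => <-.
have eq_lw : lw (wordM M) e f = map snd (merged m 0 s k.1 k.2 l.1 l.2).
  rewrite (@cells_lw r n _ Lc Lc0 g M e f ig rM neq) ek fl !vals_phi // (lab_eq sorted_m) //.
rewrite /forms_PQ pair_wordE // eq_lw.
have [h [] ->] := merged_word 0 s (ltn_ord k.1) (ltn_ord k.2) (ltn_ord l.1) (ltn_ord l.2) n1 n2;
  rewrite norm_map.
  by rewrite -eP norm_id ?eqxx //; move: hP; case: (P) => // b w.
by rewrite -eQ norm_id ?eqxx ?orbT //; move: hQ; case: (Q) => // b w.
Qed.

(* A maximal family of labels of conflict-free types is a clique, and the rows
   and columns that it uses meet the type of every label. *)
Lemma small_clique_avoids m n h Lc (Lc0 : 0 < Lc)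
    (g : {ffun 'I_n * 'I_r -> 'I_(r * m * Lc)}) (M : lmatching r n) :
  injective g -> reads g M -> zPQ P Q M <= h ->
  exists A B : {set 'I_m}, [/\ #|A| <= h, #|B| <= h & forall e, edge_cells Lc0 g e \notin
    (@phi m) @: [set k in types full m | (k.1 \notin A) && (k.2 \notin B)]].
Proof.
move=> ig rM le_h.
pose good (T : {set 'I_n * ('I_m * 'I_m)}) :=
  [forall p in T, (p.2 \in types full m) && (edge_cells Lc0 g p.1 == phi p.2)] &&
  [forall p in T, forall q in T, (p != q) ==> (p.2.1 != q.2.1) && (p.2.2 != q.2.2)].
have good0 : good set0 by apply/andP; split; apply/forall_inP=> p; rewrite inE.
case: (@arg_maxnP _ set0 good (fun T => #|T|) good0) => T /andP[/forall_inP gT1 /forall_inP gT2] maxT.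
have gT3 p q : p \in T -> q \in T -> p != q -> (p.2.1 != q.2.1) && (p.2.2 != q.2.2).
  by move=> pT qT neq; have /forall_inP/(_ q qT)/implyP := gT2 p pT; apply.
have fst_inj : {in T &, injective fst}.
  move=> [e k] [f l] kT lT /= eq_ef; have /andP[/= k1 /eqP k2] := gT1 _ kT.
  have /andP[/= l1 /eqP l2] := gT1 _ lT; rewrite eq_ef; congr pair.
  by apply: phi_inj => //; rewrite -k2 -l2 eq_ef.
have le_T : #|T| <= h.
  apply: leq_trans le_h; rewrite -(card_in_imset fst_inj); apply: zPQ_ge.
  move=> _ _ /imsetP[p pT ->] /imsetP[q qT ->] neq.
  have neq_pq : p != q by apply: contra neq => /eqP ->.
  have /andP[n1 n2] := gT3 _ _ pT qT neq_pq.
  have /andP[_ /eqP ep] := gT1 _ pT; have /andP[_ /eqP eq] := gT1 _ qT.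
  exact: (phi_forms_PQ ig rM neq ep eq n1 n2).
exists [set p.2.1 | p in T], [set p.2.2 | p in T]; split.
- exact: leq_trans (leq_imset_card _ _) le_T.
- exact: leq_trans (leq_imset_card _ _) le_T.
move=> e; apply/imsetP=> -[k /setIdP[kK /andP[nA nB]] ek].
have nkT : (e, k) \notin T by apply: contra nA => kT; apply/imsetP; exists (e, k).
have : good ((e, k) |: T).
  apply/andP; split.
    apply/forall_inP=> p; rewrite in_setU1 => /predU1P[->|]; last exact: gT1.
    by rewrite /= kK ek eqxx.
  have new q : q \in T -> (k.1 != q.2.1) && (k.2 != q.2.2).
    move=> qT; apply/andP; split.
      by apply: contra nA => /eqP ->; apply/imsetP; exists q.
    by apply: contra nB => /eqP ->; apply/imsetP; exists q.
  apply/forall_inP=> p pT'; apply/forall_inP=> q qT'; apply/implyP=> neq.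
  move: pT' qT' neq; rewrite !in_setU1 => /predU1P[->|pT] /predU1P[->|qT].
  - by rewrite eqxx.
  - by move=> _; apply: new.
  - by move=> _; have := new _ pT; rewrite ![k.1 == _]eq_sym ![k.2 == _]eq_sym.
  - exact: gT3.
by move/maxT => /=; rewrite cardsU1 nkT add1n => /(leq_trans (ltnSn _)); rewrite ltnn.
Qed.

Lemma small_clique_count n m : 4 <= m -> 28 * r ^ r * m ^ (r - full) <= n ->
  #|[set M : lmatching r n | valid_matching M && (zPQ P Q M <= m %/ 4)]| * 2 ^ m
  <= 2 * #|[set M : lmatching r n | valid_matching M]|.
Proof.
move=> le4m le_n; set X := [set M | _ && _]; pose v := #|[set M : lmatching r n | valid_matching M]|; rewrite -/v.
have r0 : 0 < r by apply: leq_ltn_trans lt_full.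
have m0 : 0 < m by apply: leq_trans le4m.
have N0 : 0 < r * m by rewrite muln_gt0 r0.
(* [f] is [m ^ full.+1 / 4] rounded up, the number of types sure to remain outside the rows and
   columns. *)
pose h := m %/ 4; pose f := (m ^ full.+1 + 3) %/ 4.
have le_h : 4 * h <= m by rewrite /h; lia.
pose S := [set j : {set 'I_m} * {set 'I_m} | (#|j.1| <= h) && (#|j.2| <= h)].
pose F (j : {set 'I_m} * {set 'I_m}) :=
  (@phi m) @: [set k in types full m | (k.1 \notin j.1) && (k.2 \notin j.2)].
have cardF j : j \in S -> f <= #|F j|.
  rewrite inE => /andP[le1 le2]; rewrite card_in_imset.
    have f_le b : m ^ full.+1 <= 4 * b -> f <= b by rewrite /f; move: (m ^ _) => a; lia.
    by apply: f_le; apply: card_types_avoid le_h le1 le2.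
  by move=> k l /setIdP[kK _] /setIdP[lK _]; apply: phi_inj.
have hX : #|X| * ((r * m) ^ r) ^ n <= 2 * #|S| * ((r * m) ^ r - f) ^ n * v.
  apply: (@avoid_count r n (r * m) _ S F) => //; first by move=> M; rewrite inE => /andP[].
  move=> Lc Lc0 g M; rewrite inE => /andP[_ le_z] ig rM.
  have [A [B [leA leB av]]] := small_clique_avoids Lc0 ig rM le_z.
  by exists (A, B) => //; rewrite inE leA leB.
have cardS : #|S| <= 4 ^ m.
  apply: leq_trans (max_card _) _.
  rewrite card_prod -(cardsT {set 'I_m}) -powersetT card_powerset cardsT card_ord.
  by rewrite -expnMn.
have leF : f <= (r * m) ^ r.
  have [j jS] : exists j, j \in S by exists (set0, set0); rewrite inE !cards0.
  apply: leq_trans (cardF j jS) _; apply: leq_trans (max_card _) _.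
  by rewrite card_ffun !card_ord.
have split_r : r = (r - full.+1) + full.+1 by rewrite subnK.
(* The types to be avoided have density at least [1 / (4 r^r m^(r - full - 1))]; hence [28 = 7 * 4],
   and the decay [8 ^ m] beats the [4 ^ m] choices of rows and columns. *)
have le7 : 7 * (r * m) ^ r <= 28 * r ^ r * m ^ (r - full.+1) * f.
  have lef : m ^ full.+1 <= 4 * f by rewrite /f; move: (m ^ _) => a; lia.
  rewrite expnMn {3}split_r expnD; have := leq_mul (leqnn (7 * r ^ r * m ^ (r - full.+1))) lef.
  by move: (r ^ r) (m ^ _) (m ^ _) => a b c; lia.
have le_n' : 28 * r ^ r * m ^ (r - full.+1) * m <= n.
  by apply: leq_trans le_n; rewrite -!mulnA -expnSr -subSn // subSS.
have T0 : 0 < (r * m) ^ r by rewrite expn_gt0 N0.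
have decay := expn_sub_exp_decay T0 leF le7 le_n'.
have Tn0 : 0 < ((r * m) ^ r) ^ n * 4 ^ m by rewrite muln_gt0 !expn_gt0 N0.
rewrite -(leq_pmul2r Tn0).
have := leq_mul hX (leqnn (8 ^ m)).
have := leq_mul cardS decay.
have -> : 8 ^ m = 2 ^ m * 4 ^ m by rewrite -expnMn.
move: (((r * m) ^ r) ^ n) (((r * m) ^ r - f) ^ n) (4 ^ m) (2 ^ m) => a b c d h1 h2.
have := leq_mul (leqnn (2 * v)) h1; move: h2; lia.
Qed.

Lemma whp_zPQ_lower : exists2 c, 0 < c &
  whp (fun n (M : lmatching r n) => n <= c * zPQ P Q M ^ (r - full)).
Proof.
have r0 : 0 < r by apply: leq_ltn_trans lt_full.
set w := r - full; have w0 : 0 < w by rewrite subn_gt0.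
set D := 28 * r ^ r; have D0 : 0 < D by rewrite muln_gt0 expn_gt0 r0.
exists (D * 8 ^ w); first by rewrite muln_gt0 D0 expn_gt0.
move=> K; exists (D * (4 + 2 * K) ^ w) => n le_n.
have exm : exists m, D * m ^ w <= n by exists 0; rewrite exp0n // muln0.
have bound m : D * m ^ w <= n -> m <= n.
  move=> le_m; apply: leq_trans le_m; apply: leq_trans (leq_pmull _ D0).
  by case: (m) => // m'; rewrite -{1}(expn1 m'.+1) leq_pexp2l.
(* For the largest [m] with [D * m ^ w <= n] one has [n < D * m.+1 ^ w], and a clique larger than
   [m %/ 4] gives [m.+1 <= 8 * zPQ P Q M]. *)
case: (ex_maxnP exm bound) => m le_m maxm.
have le_m0 : 4 + 2 * K <= m by apply: maxm.
have le4m : 4 <= m by lia.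
have lt_n : n < D * m.+1 ^ w.
  by rewrite ltnNge; apply/negP=> /maxm; rewrite ltnn.
have := small_clique_count le4m le_m.
set x := #|_|; set v := #|_|; set y := #|_| => le_x.
have le_y : y <= x.
  apply: subset_leq_card; apply/subsetP=> M; rewrite !inE => /andP[-> /=]; rewrite -ltnNge => lt.
  rewrite leqNgt; apply/negP=> ltz; have le8 : m.+1 <= 8 * zPQ P Q M by lia.
  have := leq_mul (leqnn D) (leq_expnl w le8); rewrite expnMn mulnA; lia.
have le_K : 2 * K <= 2 ^ m by apply: leq_trans (ltnW (ltn_expl m (isT : 1 < 2))); lia.
have := leq_mul le_K le_y; move: le_x; move: (2 ^ m) => e h1 h2.
by rewrite -(leq_pmul2l (isT : 0 < 2)); lia.
Qed.
End CollectableLower.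

(** * From counting to probabilities *)

Lemma card_valid_gt0 r n : 0 < #|[set M : lmatching r n | valid_matching M]|.
Proof.
have lt_rank (v : 'I_n * 'I_r) : enum_rank v < #|{: 'I_n * 'I_r}| by [].
pose g : {ffun 'I_n * 'I_r -> 'I_#|{: 'I_n * 'I_r}|} := [ffun v => enum_rank v].
have ig : injective g by move=> u v; rewrite !ffunE => /enum_rank_inj.
have [M rM] := reads_ex ig; apply/card_gt0P; exists M.
by rewrite inE; apply: reads_valid rM.
Qed.

(** Apply the counting form with an integer [K] above [1 / eps]. *)
Lemma whp_aas (R : realType) r (E : forall n, lmatching r n -> bool) :
  whp E -> aas R E.
Proof.
move=> hE eps eps0; have inv0 : (0 <= eps^-1 :> R)%R by rewrite invr_ge0 ltW.
have := archi_boundP inv0; set K := Num.bound _ => ltK.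
have [N hN] := hE K; exists N => n /hN; rewrite /prob.
set V := [set M | valid_matching M]; set bad := [set M | _ && ~~ _]; set ok := [set M | _ && _].
have cardV : #|V| = #|ok| + #|bad|.
  rewrite -(cardsID ok V); congr (_ + _); apply: eq_card => M; rewrite !inE.
    by case: (valid_matching M).
  by case: (valid_matching M); rewrite ?andbF ?andbT.
have V0 : (0 < #|V|%:R :> R)%R by rewrite ltr0n card_valid_gt0.
move=> le_bad; rewrite ler_pdivlMr // mulrBl mul1r lerBlDr {1}cardV natrD lerD2l.
have le1 : (1 <= eps * K%:R)%R.
  by rewrite -[leLHS](mulfV (lt0r_neq0 eps0)) ler_pM2l // ltW.
apply: (@le_trans _ _ (eps * K%:R * #|bad|%:R)%R); last first.
  by rewrite -mulrA ler_pM2l // -natrM ler_nat.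
by rewrite -[leLHS]mul1r ler_wpM2r.
Qed.

Lemma powR_root (R : realType) (n w : nat) : 0 < w ->
  ((powR n%:R (w%:R)^-1 : R) ^+ w = n%:R)%R.
Proof.
move=> w0; rewrite -powR_mulrn ?powR_ge0 // -powRrM mulVf ?powRr1 //.
by rewrite pnatr_eq0 -lt0n.
Qed.

Lemma aas_sandwich (R : realType) r (z : forall n, lmatching r n -> nat) w C D :
  0 < w -> 0 < C -> 0 < D ->
  whp (fun n M => z n M ^ w < C * n) -> whp (fun n M => n <= D * z n M ^ w) ->
  exists c1 c2 : R, (0 < c1)%R /\ (c1 < c2)%R /\
    aas R (fun n (M : lmatching r n) =>
      (c1 * powR n%:R (w%:R)^-1 <= (z n M)%:R)%R &&
      ((z n M)%:R <= c2 * powR n%:R (w%:R)^-1)%R).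
Proof.
move=> w0 C0 D0 hU hL.
have D0' : (0 < D%:R :> R)%R by rewrite ltr0n.
(* The [w]-th powers are compared; [m <= m ^ w] avoids roots of [C] and [D], and [C.+1] makes the
   second constant exceed [1]. *)
exists (D%:R^-1)%R, ((C.+1)%:R)%R; split; first by rewrite invr_gt0.
split.
  apply: (@le_lt_trans _ _ 1%R); last by rewrite ltr1n.
  by rewrite invf_le1 // ler1n.
apply: whp_aas; have := whp_and hU hL; apply: whp_imp; exists 0 => n M _ _.
have x0 : (0 <= powR n%:R (w%:R)^-1 :> R)%R by apply: powR_ge0.
have xw := powR_root R n w0; move: x0 xw; set x := powR _ _ => x0 xw /andP[ltC leD].
have le_pow m : 0 < m -> m <= m ^ w.
  by move=> m0; case: m m0 => // m _; rewrite -{1}(expn1 m.+1) leq_pexp2l.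
apply/andP; split.
  rewrite mulrC ler_pdivrMr // mulrC -(@ler_pXn2r _ w) ?nnegrE ?mulr_ge0 //.
  rewrite xw exprMn -!natrX -natrM ler_nat; apply: leq_trans leD _.
  by rewrite leq_mul2r le_pow ?orbT.
rewrite -(@ler_pXn2r _ w) ?nnegrE ?mulr_ge0 //.
rewrite exprMn xw -!natrX -natrM ler_nat; apply: leq_trans (ltnW ltC) _.
rewrite leq_mul2r; apply/orP; right; apply: leq_trans (leqnSn _) (le_pow _ _) => //.
Qed.

(** * Assembling the three cases *)

Lemma segs_of_blocks bsP bsQ P Q : block_decomp P bsP -> block_decomp Q bsQ ->
  map snd bsP = map snd bsQ ->
  exists s, [/\ P = segsP s, Q = segsQ s & all (fun z => 0 < z.2) s].
Proof.
elim: bsP bsQ P Q => [|[b t] bsP IH] [|[b' t'] bsQ] P Q //.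
  by move=> [_ ->] [_ ->] _; exists [::].
move=> /block_decomp_cons[P1 -> [t0 dP]] /block_decomp_cons[Q1 -> [_ dQ]] [<- es].
have [s [-> -> pos]] := IH _ _ _ dP dQ es.
by exists ((b, b', t) :: s); split; rewrite /segsP /segsQ /= -?catA ?t0.
Qed.

Lemma size_segsP s : size (segsP s) = 2 * sumn (map snd s).
Proof. by elim: s => //= z s IH; rewrite /segsP /= !size_cat !size_nseq -/(segsP s) IH; lia. Qed.

Lemma segsPQ_eq s : ~~ has (fun z => z.1.1 != z.1.2) s -> segsP s = segsQ s.
Proof.
move=> /hasPn same; congr flatten; apply/eq_in_map => z zs.
by have := same z zs; rewrite negbK => /eqP ->.
Qed.

Lemma whp_collectable_lower r P Q bsP bsQ (full : bool) :
  full < r -> is_pattern r P -> is_pattern r Q ->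
  block_decomp P bsP -> block_decomp Q bsQ -> map snd bsP = map snd bsQ ->
  (full -> P <> Q) -> exists2 c, 0 < c &
  whp (fun n (M : lmatching r n) => n <= c * zPQ P Q M ^ (r - full)).
Proof.
move=> lt_full /and3P[/eqP size_P _ /eqP hP] /and3P[_ _ /eqP hQ] dP dQ es neq.
have [s [eP eQ pos]] := segs_of_blocks dP dQ es.
apply: (whp_zPQ_lower eP eQ) => //.
- by apply/eqP; rewrite -(eqn_pmul2l (isT : 0 < 2)) -size_segsP -eP size_P.
(* Both patterns start with A, so their first blocks have the same direction. *)
- move: hP hQ pos; rewrite eP eQ; case: (s) => [|[[b b'] [|t]] s'] //=.
  by rewrite /segsP /segsQ /= => -> ->.
move=> isfull; case: (boolP (has _ s)) => // /segsPQ_eq.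
by rewrite -eP -eQ => /(neq isfull).
Qed.

Lemma zPQ_same_le r n P Q X (M : lmatching r n) : X = P \/ X = Q ->
  zPQ X X M <= zPQ P Q M.
Proof.
move=> eX; apply/bigmax_leqP => S /is_cliqueP cl; apply: zPQ_ge => e f eS fS neq.
by have := cl e f eS fS neq; rewrite /forms_PQ orbb; case: eX => -> ->; rewrite ?orbT.
Qed.

(** The word [P] itself is a matching of size 2, which shows that the maximal clique size is at
    least 2. *)
Lemma pattern_clique r P Q : is_pattern r P -> exists M, M \in full_cliques r 2 P Q.
Proof.
move=> pP; have bP := is_pattern_balanced pP; have /and3P[/eqP size_P _ /eqP hP] := pP.
pose lift (b : bool) : 'I_2 := if b then ord_max else ord0.
pose M : lmatching r 2 := [ffun i : 'I_(r * 2) => lift (nth false P i)].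
have word_M : wordM M = map lift P.
  rewrite /wordM (eq_map (_ : _ =1 (lift \o nth false P) \o val)); last first.
    by move=> i; rewrite ffunE.
  rewrite map_comp val_enum_ord map_comp map_nth_iota0 ?take_oversize // size_P; lia.
have lw01 : lw (wordM M) ord0 ord_max = P.
  rewrite word_M /lw filter_map -map_comp (eq_filter (_ : _ =1 predT)) ?filter_predT; last by case.
  by rewrite -[RHS]map_id; apply: eq_map => -[].
have neq01 : (ord0 : 'I_2) != ord_max by [].
have normP : norm P = P by apply: norm_id; move: hP; case: (P).
exists M; rewrite inE; apply/andP; split.
  apply/forallP=> e; rewrite -count_wordM_card word_M count_map.
  have [->|ne] := eqVneq e ord0.
    by rewrite -[X in _ == X](bP false); apply/eqP/eq_count => -[].
  have -> : e = ord_max by apply: val_inj; case: e ne => -[|[|]].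
  by rewrite -[X in _ == X](bP true); apply/eqP/eq_count => -[].
apply/is_cliqueP=> e f _ _ neq; rewrite /forms_PQ pair_wordE //.
have two (x : 'I_2) : x = ord0 \/ x = ord_max.
  by case: x => -[|[|]] // lt; [left | right]; apply: val_inj.
case: (two e) (two f) neq => -> [] -> // _; first by rewrite lw01 normP eqxx.
by rewrite lw_sym // lw01 norm_map normP eqxx.
Qed.

(** A largest clique, relabelled, is a matching of its own; so the size of any clique inside a
    matching is bounded by the largest full clique. *)
Lemma zPQ_full_clique r n P Q (M : lmatching r n) : valid_matching M ->
  exists M', M' \in full_cliques r (zPQ P Q M) P Q.
Proof.
move=> vM; have [t [st cl]] := clique_tuple (leqnn (zPQ P Q M)).
have [g] := readers_ex (leqnn (r * n)) vM; rewrite inE => /andP[/injectiveP ig rM].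
have [M' M'cl _] := restr_full_clique ig rM (sorted_tuple_uniq st) cl.
by exists M'.
Qed.

Lemma noncollectable_whp r P Q : 0 < r -> is_pattern r P -> is_pattern r Q ->
  ~ collectable P -> ~ collectable Q ->
  exists z, [/\ 2 <= z <= 5, exists M, M \in full_cliques r z P Q,
    forall n (M : lmatching r n), M \in full_cliques r n P Q -> n <= z &
    whp (fun n (M : lmatching r n) => zPQ P Q M == z)].
Proof.
move=> r0 pP pQ ncP ncQ.
pose has_clique n := [exists M, M \in full_cliques r n P Q].
have has2 : has_clique 2 by apply/existsP; apply: pattern_clique.
have le5 n : has_clique n -> n <= 5.
  move=> /existsP[M]; rewrite inE => /andP[_ cl].
  exact: noncollectable_clique_le5 pP pQ ncP ncQ cl.
case: (ex_maxnP (ex_intro _ 2 has2) le5) => z /[dup] /le5 le_z5 /existsP[M0 M0cl] maxz.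
have le2z : 2 <= z by apply: maxz.
exists z; split; first by rewrite le2z.
- by exists M0.
- by move=> n M Mcl; apply: maxz; apply/existsP; exists M.
move: M0cl; rewrite inE => /andP[v0 cl0].
have z0 : 0 < z by apply: leq_trans le2z.
have := whp_contains_clique r0 z0 v0 cl0; apply: whp_imp; exists 0 => n M _ vM le_z.
rewrite eqn_leq le_z andbT; apply: maxz; apply/existsP; exact: zPQ_full_clique.
Qed.

Theorem theorem2p2 (R : realType) (r : nat) (hr : (2 <= r)%N)
  (P Q : seq bool) (hP : is_pattern r P) (hQ : is_pattern r Q) (hPQ : P <> Q) :
  (harmonious P Q ->
     exists c C : R, (0 < c)%R /\ (c < C)%R /\
       aas R (fun n (M : lmatching r n) =>
         (c * powR (n%:R) ((r - 1)%:R)^-1 <= (zPQ P Q M)%:R)%R &&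
         ((zPQ P Q M)%:R <= C * powR (n%:R) ((r - 1)%:R)^-1)%R)) /\
  (mismatch P Q ->
     exists c C : R, (0 < c)%R /\ (c < C)%R /\
       aas R (fun n (M : lmatching r n) =>
         (c * powR (n%:R) (r%:R)^-1 <= (zPQ P Q M)%:R)%R &&
         ((zPQ P Q M)%:R <= C * powR (n%:R) (r%:R)^-1)%R)) /\
  (~ collectable P -> ~ collectable Q ->
     exists z : nat, [/\ (2 <= z <= 5)%N,
       (exists n (M : lmatching r n),
          [/\ valid_matching M, is_clique P Q M [set: 'I_n] & n = z]),
       (forall n (M : lmatching r n),
          valid_matching M -> is_clique P Q M [set: 'I_n] -> (n <= z)%N) &
       aas R (fun n (M : lmatching r n) => zPQ P Q M == z)]).
Proof.
have r0 : (0 < r)%N by apply: leq_trans hr.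
split; [|split].
- move=> harm; have [_ [bsP [bsQ [dP [dQ es]]]]] := harm.
  have [D D0 hL] := @whp_collectable_lower r P Q bsP bsQ true hr hP hQ dP dQ es (fun=> hPQ).
  have hU := @whp_zPQ_upper r 1 1 P Q isT hr (fun k => card_harmonious_cliques k hP harm).
  by apply: aas_sandwich hU hL; rewrite ?subn_gt0 ?muln_gt0 ?expn_gt0.
- move=> mis.
  have hU := whp_zPQ_upper (d := 0) (_ : 0 < r ^ r) r0 (fun k => card_mismatch_cliques k hP hQ mis).
  (* At least one pattern [X] of a mismatch is collectable, and cliques of [X] alone already have
     order [n ^ (1/r)]; they come from diagonal types. *)
  have [X [bs [eX pX dX]]] : exists X bs, [/\ X = P \/ X = Q, is_pattern r X & block_decomp X bs].
    case: mis => [[[bs d] _]|[[_ [bs d]]|[[bs d] _]]].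
    + by exists P, bs; split; [left | |].
    + by exists Q, bs; split; [right | |].
    + by exists P, bs; split; [left | |].
  have [D D0 hL] := @whp_collectable_lower r X X bs bs false r0 pX pX dX dX erefl (fun h => match notF h with end).
  rewrite !subn0 in hU hL.
  have rr0 : (0 < r ^ r)%N by rewrite expn_gt0 r0.
  apply: aas_sandwich r0 _ D0 (hU rr0) _; first by rewrite !muln_gt0 expn_gt0 rr0.
  apply: (whp_imp _ hL); exists 0%N => n M _ _ le_n; apply: leq_trans le_n _.
  by rewrite leq_mul2l leq_expnl ?orbT // zPQ_same_le.
- move=> ncP ncQ.
  have [z [z25 [M0 M0cl] maxz hz]] := noncollectable_whp r0 hP hQ ncP ncQ.
  exists z; split => //.
  + by exists z, M0; move: M0cl; rewrite inE => /andP[].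
  + by move=> n M vM cl; apply: (maxz n M); rewrite inE vM.
  + exact: whp_aas hz.
Qed.
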